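(* There are absolute constants $c_1,c_2,C>0$ such that the following holds. Suppose $|a+b|\ge\epsilon^5$. Then for $\alpha_1=-c_1\epsilon^{82}/d$ and $\alpha_2=-c_2\epsilon^{42}/d$, the re-weighted means $\mu_{\alpha_1},\mu_{\alpha_2}$ of $P$, where $\mu_\alpha=\mathbb{E}_{x\sim P}\,e^{\alpha\|x\|^2}x$, satisfy $$\max\left(|u^\top\mu_{\alpha_1}|,\ |u^\top\mu_{\alpha_2}|\right)>\frac{C\epsilon^{159}}{d^2},$$ and $$v^\top\mu_{\alpha_1}=v^\top\mu_{\alpha_2}=0\quad\text{for all } v\perp u.$$
   Context: Let $\epsilon>0$ and let $q$ be a symmetric (about $0$) one-dimensional isotropic (mean $0$, variance $1$) logconcave density. Let $a<b$ satisfy $q((-\infty,a])\ge\epsilon$, $q([a,b])\ge\epsilon$, $q([b,\infty))\ge\epsilon$, where $q(I)=\int_I q$. Let $\tilde q$ be $q$ restricted to $\mathbb{R}\setminus[a,b]$ and renormalized, and let $\hat q$ be the isotropized density, i.e. the density of $(X-\mu_1)/\sigma_1$ for $X\sim\tilde q$, where $\mu_1,\sigma_1^2$ are the mean and variance of $\tilde q$. Let $P=\hat q\otimes q\otimes\cdots\otimes q$ on $\mathbb{R}^d$ (one copy of $\hat q$, $d-1$ copies of $q$), and let $u=e_1$ be the unit vector normal to the margin. $\|\cdot\|$ is the Euclidean norm. *)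

(* Defs.v *)
From HB Require Import structures.
From mathcomp Require Import all_boot all_order all_algebra.
From mathcomp Require Import all_classical all_reals all_analysis.
From mathcomp Require Import measurable_realfun.

Set Implicit Arguments.
Unset Strict Implicit.
Unset Printing Implicit Defensive.

Import Order.TTheory GRing.Theory Num.Theory.
Import numFieldNormedType.Exports.

Local Open Scope classical_set_scope.
Local Open Scope ring_scope.

Record density (R : realType) := Density {
  pdf :> R -> R;
  measurable_pdf : measurable_fun [set: R] pdf;
  pdf_ge0 : forall x, 0 <= pdf x;
  integral_pdf : (\int[lebesgue_measure]_x (pdf x)%:E = 1)%E }.

Definition symmetric_pdf (R : realType) (q : R -> R) :=
  forall x, q (- x) = q x.

(* Since powR 0 0 = 1, the endpoints t = 0 and t = 1 impose nothing, even where
   q vanishes. *)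
Definition logconcave (R : realType) (q : R -> R) :=
  forall x y t, 0 <= t <= 1 ->
    q x `^ t * q y `^ (1 - t) <= q (t * x + (1 - t) * y).

Definition law (R : realType) (q : density R) (A : set R) : \bar R :=
  (\int[lebesgue_measure]_(x in A) (q x)%:E)%E.

Section law.
Context (R : realType) (q : density R).

Let law0 : law q set0 = 0%E.
Proof. by rewrite /law integral_set0. Qed.

Let law_ge0 A : (0 <= law q A)%E.
Proof. by apply: integral_ge0 => x _; rewrite lee_fin pdf_ge0. Qed.

Let law_sigma_additive : semi_sigma_additive (law q).
Proof.
move=> /= F mF tF mUF; rewrite /law; apply: cvg_toP.
  apply: ereal_nondecreasing_is_cvgn => m n mn.
  apply: lee_sum_nneg_natr => // k _ _; apply: integral_ge0 => /= x Fkx.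
  by rewrite lee_fin pdf_ge0.
rewrite ge0_integral_bigcup//=.
- apply: (@measurable_funS _ _ _ _ setT) => //.
  by apply/measurable_EFinP; exact: measurable_pdf.
- by move=> x _; rewrite lee_fin pdf_ge0.
Qed.

HB.instance Definition _ :=
  isMeasure.Build _ _ _ (law q) law0 law_ge0 law_sigma_additive.

Let law_setT : law q [set: R] = 1%E.
Proof. exact: integral_pdf. Qed.

HB.instance Definition _ := Measure_isProbability.Build _ _ R (law q) law_setT.

End law.

Definition isotropic (R : realType) (P : probability R R) :=
  ('E_P[id] = 0 /\ 'V_P[id] = 1)%E.

(* The second argument of mnormalize is a default, used only if the complement of
   [a, b] is P-null. *)
Definition remove_band (R : realType) (P : probability R R) (a b : R) :
    probability R R :=
  mnormalize (mrestr P (measurableC (measurable_itv `[a, b]))) P.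

Definition standardize (R : realType) (P : probability R R) (x : R) : R :=
  (x - fine ('E_P[id])%E) / Num.sqrt (fine ('V_P[id])%E).

Section standardize.
Context (R : realType) (P : probability R R).

Let measurable_standardize : measurable_fun [set: R] (standardize P).
Proof. by apply: measurable_funM => //; exact: measurable_funB. Qed.

HB.instance Definition _ :=
  isMeasurableFun.Build _ _ R R (standardize P) measurable_standardize.

End standardize.

Definition isotropize (R : realType) (P : probability R R) : probability R R :=
  distribution P (standardize P).

Definition mcons d (T : measurableType d) n (x : T * n.-tuple T) :
  n.+1.-tuple T := [tuple of x.1 :: x.2].

Section mcons.
Context d (T : measurableType d) (n : nat).

Let measurable_mcons : measurable_fun [set: T * n.-tuple T] (@mcons d T n).
Proof. exact: measurable_cons. Qed.

HB.instance Definition _ :=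
  isMeasurableFun.Build _ _ _ _ (@mcons d T n) measurable_mcons.

End mcons.

Fixpoint tuple_prob d (T : measurableType d) (R : realType) n :
    ('I_n -> probability T R) -> probability (n.-tuple T) R :=
  match n return ('I_n -> probability T R) -> probability (n.-tuple T) R with
  | 0 => fun=> dirac [tuple]
  | n'.+1 => fun P =>
      distribution (P ord0 \x tuple_prob (fun i => P (lift ord0 i)))%E
                   (@mcons d T n')
  end.

(* The norm of the library on vectors is the sup norm. *)
Definition enorm (R : realType) d (x : d.-tuple R) : R :=
  Num.sqrt (\sum_(i < d) tnth x i ^+ 2).

(* Not normalized by the total weight. *)
Definition reweighted_mean (R : realType) d (P : probability (d.-tuple R) R)
    (alpha : R) : 'rV[R]_d :=
  \row_i fine ('E_P[fun x => (expR (alpha * enorm x ^+ 2) * tnth x i)%R])%E.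

Definition dotr (R : realType) d (u v : 'rV[R]_d) : R := \sum_i u 0 i * v 0 i.

Definition margin_prob (R : realType) (q : density R) (a b : R) d :
    probability (d.-tuple R) R :=
  tuple_prob (fun i : 'I_d =>
    if i == 0%N :> nat then isotropize (remove_band (law q) a b) else law q).

Definition margin_normal (R : realType) d : 'rV[R]_d :=
  \row_i (i == 0%N :> nat)%:R.

(* Main.v *)
(** Write g for the indicator of the complement of [a, b], Z and m for the mass
    and mean of g q, and V for its normalized variance.  Suppose a + b < 0, so
    that m >= 0, and put r = m - a, s = max(0, m - b).  Reflecting about m, the
    function t |-> (g q)(m + t) - (g q)(m - t) on t > 0 has the signs -, +, - on
    (0, s), (s, r), (r, +oo), because q is even and unimodal.  Hence integrating
    g q against the odd polynomial y (y^2 - s^2) (r^2 - y^2), y = x - m, gives a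
    positive quantity, and since the first centered moment vanishes it equals
    (s^2 + r^2) M3 - M5.  So the third and fifth moments of the isotropized law
    cannot both be tiny.  As the other factors of the product are even, only the
    first coordinate of the re-weighted mean survives, and Taylor expansion of
    E[exp(al x^2) x] = al M3 + al^2 M5 / 2 + O(al^3) detects M3 at al = alpha_1
    and M5 at al = alpha_2. *)
Require Import Defs.
From HB Require Import structures.
From mathcomp Require Import all_boot all_order all_algebra.
From mathcomp Require Import all_classical all_reals all_analysis.
From mathcomp Require Import measurable_realfun ring lra.
Set Implicit Arguments.
Unset Strict Implicit.
Unset Printing Implicit Defensive.
Import Order.TTheory GRing.Theory Num.Theory.
Import numFieldNormedType.Exports.
Local Open Scope classical_set_scope.
Local Open Scope ring_scope.

(** * Integration *)

(** The argument does not exclude that the third or the fifth moment vanishes by itself; it bounds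
    only a combination of the two, hence two weights. An odd polynomial with two prescribed positive
    roots has degree at least five, and its linear coefficient is harmless because the moments are
    centered. Positivity has to be quantitative. It is extracted from a short interval to the right
    of both [b] and its mirror image [2m - b], but to the left of [2m - a]: its points are kept
    while their mirror images lie in the removed band, so nothing cancels. If [m <= b], it is the
    lower bound on [|a + b|] that leaves room for this interval. The obstacle is that [q] might be
    tiny there; the mass further to the right, together with unimodality, rules this out.
    Logconcavity enters the estimates only through unimodality, a bound on the density and a bound
    on the eighth moment, the last two by an absolute constant [K]. Every later loss is a power of
    [eps] times a power of [K], which fixes the exponents 82, 42 and 159 up to some slack. *)

(* [lebesgue_measure] lives on [measurableTypeR R], whose display differs from
   that of [R], so the law of a density is itself handled as a pushforward, by
   the identity. *)
Section pushforward_density.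
Local Open Scope ereal_scope.
Context d1 d2 (T1 : measurableType d1) (T2 : measurableType d2) (R : realType).
Variables (mu : {measure set T1 -> \bar R}) (nu : {measure set T2 -> \bar R}).
Variables (phi : T1 -> T2) (w : T1 -> R).
Hypotheses (mphi : measurable_fun [set: T1] phi).
Hypotheses (mw : measurable_fun [set: T1] w) (w0 : forall x, (0 <= w x)%R).
Hypothesis nuE : forall A, measurable A ->
  nu A = \int[mu]_(x in phi @^-1` A) (w x)%:E.

Import HBNNSimple.

Let mwE : measurable_fun [set: T1] (fun x => (w x)%:E).
Proof. exact/measurable_EFinP. Qed.

Let mpre A : measurable A -> measurable (phi @^-1` A).
Proof. by move=> mA; rewrite -[_ @^-1` _]setTI; exact: mphi. Qed.

Let integral_nnsfun (f : {nnsfun T2 >-> R}) :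
  \int[nu]_x (f x)%:E = \int[mu]_x ((f (phi x))%:E * (w x)%:E).
Proof.
have mind r : measurable_fun setT (fun x => (r * \1_(f @^-1` [set r]) x)%:E).
  by apply/measurable_EFinP; exact: measurable_funM.
transitivity (\sum_(k \in range f)
    \int[mu]_x ((k * \1_(f @^-1` [set k]) (phi x))%:E * (w x)%:E)).
  under eq_integral do rewrite fimfunE -fsumEFin//.
  rewrite ge0_integral_fsum//; last first.
    by move=> y x _; rewrite nnfun_muleindic_ge0.
  apply: eq_fsbigr => r _; rewrite integralZl_indic_nnsfun// integral_indic//=.
  rewrite setIT nuE//.
  have [r0|r0] := ltP r 0%R.
    rewrite preimage_nnfun0// preimage_set0 integral_set0 mule0 integral0_eq// => x _.
    by rewrite indic0 mulr0 mul0e.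
  have mf1 : measurable (phi @^-1` (f @^-1` [set r])) by exact: mpre.
  rewrite -ge0_integralZl_EFin//; last 2 first.
  - by move=> x _; rewrite lee_fin.
  - exact: measurable_funTS.
  rewrite integral_mkcond; apply: eq_integral => x _.
  rewrite patchE indicE.
  have -> : (x \in phi @^-1` (f @^-1` [set r])) = (phi x \in f @^-1` [set r]).
    by apply/idP/idP; rewrite !inE.
  case: ifPn => _; first by rewrite mulr1.
  by rewrite mulr0 mul0e.
rewrite -ge0_integral_fsum//; last 2 first.
- by move=> r; apply: emeasurable_funM => //; exact: (measurableT_comp (mind r)).
- by move=> r x _; apply: mule_ge0; rewrite ?lee_fin//; exact: nnfun_muleindic_ge0.
apply: eq_integral => x _; rewrite [in RHS](fimfunE f) -fsumEFin//.
by rewrite ge0_mule_fsuml// => r; exact: nnfun_muleindic_ge0.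
Qed.

(** Density and push-forward are treated together because the isotropized law is the image of
    [law q] under [standardize] with weight [gap a b x / Z]. The truncated law is the same situation
    with the identity map. *)
Lemma ge0_integral_pushforward_density (f : T2 -> \bar R) :
  measurable_fun [set: T2] f -> (forall x, 0 <= f x) ->
  \int[nu]_x f x = \int[mu]_x (f (phi x) * (w x)%:E).
Proof.
move=> mf f0; pose f_ := nnsfun_approx measurableT mf.
have f_f x : (f_ n x)%:E @[n --> \oo] --> f x by exact: cvg_nnsfun_approx.
transitivity (limn (fun n => \int[nu]_x (f_ n x)%:E)).
  rewrite -monotone_convergence//.
  - by apply: eq_integral => x _; exact/esym/cvg_lim.
  - by move=> n; exact/measurable_EFinP.
  - by move=> n x _; rewrite lee_fin.
  - by move=> x _ m n mn; rewrite lee_fin; exact/lefP/nd_nnsfun_approx.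
under eq_fun do rewrite integral_nnsfun.
rewrite -monotone_convergence//.
- apply: eq_integral => x _; apply/cvg_lim => //.
  by apply: cvgeZr => //; exact: f_f.
- move=> n; apply: emeasurable_funM => //; apply/measurable_EFinP.
  exact: measurableT_comp.
- by move=> n x _; rewrite mule_ge0 ?lee_fin.
- move=> x _ m n mn; rewrite lee_wpmul2r ?lee_fin//.
  exact/lefP/nd_nnsfun_approx.
Qed.

Lemma integral_pushforward_density (f : T2 -> R) : measurable_fun [set: T2] f ->
  \int[nu]_x (f x)%:E = \int[mu]_x (f (phi x) * w x)%:E.
Proof.
move=> mf; have mfE : measurable_fun [set: T2] (EFin \o f) by exact/measurable_EFinP.
rewrite integralE [RHS]integralE.
rewrite !ge0_integral_pushforward_density//; last 2 first.
- exact: measurable_funeneg.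
- exact: measurable_funepos.
congr (_ - _); apply: eq_integral => x _; rewrite ?(funeposE, funenegE) /=.
- by rewrite -!EFin_max -EFinM maxr_pMl// mul0r.
- by rewrite -!EFin_max -EFinM maxr_pMl// mul0r mulNr.
Qed.

Lemma integrable_pushforward_density (f : T2 -> R) : measurable_fun [set: T2] f ->
  nu.-integrable [set: T2] (EFin \o f) <->
  mu.-integrable [set: T1] (fun x => (f (phi x) * w x)%:E).
Proof.
move=> mf.
have mfw : measurable_fun [set: T1] (fun x => f (phi x) * w x)%R.
  by apply: measurable_funM => //; exact: measurableT_comp.
have E : \int[nu]_x `|(f x)%:E| = \int[mu]_x `|(f (phi x) * w x)%:E|.
  rewrite ge0_integral_pushforward_density//; last first.
    by apply: measurableT_comp => //; exact/measurable_EFinP.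
  by apply: eq_integral => x _; rewrite /= normrM (ger0_norm (w0 x)).
split => /integrableP[_ ifoo]; apply/integrableP; split.
- exact/measurable_EFinP.
- by rewrite -E.
- exact/measurable_EFinP.
- by rewrite E.
Qed.

End pushforward_density.


(** * Reflections of the line *)

Section reflection.
Context (R : realType).
Notation mu := (@lebesgue_measure R).
Local Open Scope ereal_scope.

Let refl (c : R) (x : measurableTypeR R) : measurableTypeR R := (c - x)%R.

Let measurable_refl (c : R) : measurable_fun setT (refl c).
Proof. exact: (@measurable_funB _ _ R). Qed.

Lemma lebesgue_measure_reflect (c : R) (A : set R) : measurable A ->
  pushforward mu (refl c) A = mu A.
Proof.
move=> mA.
pose mrefl := isMeasurableFun.Build _ _ _ _ _ (measurable_refl c).
pose refl_pack : {mfun _ >-> _} := HB.pack (refl c) mrefl.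
apply/esym; apply: (@lebesgue_measure_unique _ (pushforward mu refl_pack)) => //= _ [[a b]] _ <-.
rewrite /pushforward/=.
rewrite (_ : _ @^-1` _ = `[c - b, c - a[%classic)%R; last first.
  by apply/seteqP; split => x /=; rewrite /refl !in_itv/= => /andP[h1 h2];
    apply/andP; move: h1 h2; split; lra.
rewrite !lebesgue_measure_itv/= !lte_fin.
have -> : (c - b < c - a)%R = (a < b)%R by apply/idP/idP; lra.
by case: ifPn => // _; congr EFin; lra.
Qed.

Lemma integral_reflect (c : R) (f : R -> R) :
  measurable_fun [set: R] f -> mu.-integrable [set: R] (EFin \o f) ->
  mu.-integrable [set: R] (fun x => (f (c - x))%:E) /\
  \int[mu]_x (f (c - x))%:E = \int[mu]_x (f x)%:E.
Proof.
move=> mf intf.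
have E (g : R -> \bar R) : measurable_fun setT g -> (forall x, 0 <= g x) ->
    \int[mu]_x g (c - x)%R = \int[mu]_x g x.
  move=> mg g0.
  rewrite -(@ge0_integral_pushforward _ _ _ _ _ _ (measurable_refl c) mu setT g)//.
  apply: eq_measure_integral => //= A mA _; exact: lebesgue_measure_reflect.
have mfE : measurable_fun [set: R] (EFin \o f) by exact/measurable_EFinP.
have mfc : measurable_fun [set: R] (fun x => (f (c - x))%:E).
  by apply: measurableT_comp => //; apply: (measurableT_comp mf); exact: measurable_refl.
split.
  apply/integrableP; split => //.
  have /integrableP[_] := intf.
  rewrite -(E (fun x => `|(EFin \o f) x|))//.
  exact: measurableT_comp.
rewrite integralE [RHS]integralE; congr (_ - _).
- rewrite -(E (EFin \o f)^\+)//; last exact: measurable_funepos.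
  by apply: eq_integral => x _; rewrite !funeposE.
- rewrite -(E (EFin \o f)^\-)//; last exact: measurable_funeneg.
  by apply: eq_integral => x _; rewrite !funenegE.
Qed.

End reflection.

(** * Functions of polynomial growth *)

Section polynomial_growth.
Context (R : realType).
Implicit Types (f g : R -> R) (j k : nat).

(** The exponent turns integrability into counting degrees: it adds up under products and becomes a
    maximum under sums, so it can be read off the expression for [f]. *)
Definition growth k f := measurable_fun [set: R] f /\
  exists2 C, 0 <= C & forall x, `|f x| <= C * (1 + `|x|) ^+ k.

Lemma growth_le j k f : (j <= k)%N -> growth j f -> growth k f.
Proof.
move=> jk [mf [C C0 fC]]; split=> //; exists C => // x.
apply: (le_trans (fC x)); rewrite ler_wpM2l//.
by rewrite ler_weXn2l// lerDl.
Qed.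

Lemma growth_cst (c : R) : growth 0 (cst c).
Proof. by split => //; exists `|c| => // x; rewrite expr0 mulr1. Qed.

Lemma growth_id : growth 1 id.
Proof. by split => //; exists 1 => // x; rewrite expr1 mul1r lerDr. Qed.

Lemma growth_indic (A : set R) : measurable A -> growth 0 \1_A.
Proof.
move=> mA; split; first exact: measurable_indic.
by exists 1 => // x; rewrite expr0 mulr1 indicE; case: (_ \in _); rewrite ?normr1 ?normr0.
Qed.

Lemma growthM j k f g : growth j f -> growth k g ->
  growth (j + k) (fun x => f x * g x).
Proof.
move=> [mf [C C0 fC]] [mg [D D0 gD]]; split; first exact: measurable_funM.
exists (C * D); first exact: mulr_ge0.
by move=> x; rewrite normrM exprD mulrACA ler_pM.
Qed.

Lemma growthD j k f g : growth j f -> growth k g ->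
  growth (maxn j k) (fun x => f x + g x).
Proof.
move=> /(growth_le (leq_maxl _ k)) [mf [C C0 fC]].
move=> /(growth_le (leq_maxr j _)) [mg [D D0 gD]]; split; first exact: measurable_funD.
exists (C + D); first exact: addr_ge0.
by move=> x; rewrite mulrDl (le_trans (ler_normD _ _))// lerD.
Qed.

Lemma growthN k f : growth k f -> growth k (fun x => - f x).
Proof.
move=> [mf [C C0 fC]]; split; first exact: measurable_funN.
by exists C => // x; rewrite normrN.
Qed.

Lemma growthB j k f g : growth j f -> growth k g ->
  growth (maxn j k) (fun x => f x - g x).
Proof. by move=> fj /growthN; exact: growthD. Qed.

Lemma growthX k f n : growth k f -> growth (k * n) (fun x => f x ^+ n).
Proof.
move=> [mf [C C0 fC]]; split; first exact: measurable_funX.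
exists (C ^+ n); first exact: exprn_ge0.
by move=> x; rewrite normrX exprM -exprMn lerXn2r// nnegrE ?mulr_ge0// ?exprn_ge0// addr_ge0.
Qed.

Lemma growth_norm k f : growth k f -> growth k (fun x => `|f x|).
Proof.
move=> [mf [C C0 fC]]; split; first exact: measurableT_comp.
by exists C => // x; rewrite normr_id.
Qed.

Lemma growth_comp k f (c m : R) : growth k f -> growth k (fun x => f (c * x + m)).
Proof.
move=> [mf [C C0 fC]]; split.
  by apply: (measurableT_comp mf); apply: measurable_funD => //; exact: measurable_funM.
exists (C * (1 + `|c| + `|m|) ^+ k).
  by rewrite mulr_ge0// exprn_ge0// !addr_ge0.
move=> x; apply: (le_trans (fC _)); rewrite -mulrA ler_wpM2l//.
rewrite -exprMn lerXn2r// ?nnegrE ?mulr_ge0 ?addr_ge0//.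
have := ler_normD (c * x) m; rewrite normrM => h.
have := normr_ge0 x; have := normr_ge0 c; have := normr_ge0 m.
by have := mulr_ge0 (normr_ge0 m) (normr_ge0 x); nra.
Qed.

End polynomial_growth.

Section expectation_wrt_density.
Context (R : realType) (q : density R).
Notation mu := (@lebesgue_measure R).
Implicit Types (f g G : R -> R).

Let mq : measurable_fun setT q. Proof. exact: measurable_pdf. Qed.

Let lawE (A : set R) : measurable A -> law q A = (\int[mu]_(x in id @^-1` A) (q x)%:E)%E.
Proof. by []. Qed.

Let mid : measurable_fun [set: measurableTypeR R] (id : measurableTypeR R -> R).
Proof. exact: (@measurable_id _ R). Qed.

Lemma integrable_law f : measurable_fun setT f ->
  (law q).-integrable [set: R] (EFin \o f) <->
  mu.-integrable [set: R] (EFin \o (fun x => f x * q x)).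
Proof.
by move=> mf; exact: (integrable_pushforward_density mid mq (pdf_ge0 q) lawE mf).
Qed.

Lemma Rintegral_law f : measurable_fun setT f ->
  \int[law q]_x f x = \int[mu]_x (f x * q x).
Proof.
move=> mf; congr fine.
exact: (integral_pushforward_density mid mq (pdf_ge0 q) lawE mf).
Qed.

Lemma le_Rintegral_law f G : (law q).-integrable [set: R] (EFin \o f) ->
  mu.-integrable [set: R] (EFin \o G) ->
  (forall x, f x * q x <= G x) -> \int[law q]_x f x <= \int[mu]_x G x.
Proof.
move=> intf intG fG.
have mf : measurable_fun setT f by case/integrableP: intf => /measurable_EFinP.
rewrite Rintegral_law//; apply: le_Rintegral => //.
by apply/integrable_law.
Qed.

Lemma ge_Rintegral_law f G : (law q).-integrable [set: R] (EFin \o f) ->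
  mu.-integrable [set: R] (EFin \o G) ->
  (forall x, G x <= f x * q x) -> \int[mu]_x G x <= \int[law q]_x f x.
Proof.
move=> intf intG fG.
have mf : measurable_fun setT f by case/integrableP: intf => /measurable_EFinP.
rewrite Rintegral_law//; apply: le_Rintegral => //.
by apply/integrable_law.
Qed.

(** Folding the line at [c / 2] writes twice the expectation as the integral of the integrand plus
    its mirror image, so a pointwise bound may use cancellation between mirror points. Keeping both
    halves costs the factor 2 and avoids integrals over half-lines. *)
Lemma reflect_Rintegral_law c f G :
  (law q).-integrable [set: R] (EFin \o f) ->
  mu.-integrable [set: R] (EFin \o G) ->
  (forall x, G x <= f x * q x + f (c - x) * q (c - x)) ->
  \int[mu]_x G x <= 2 * \int[law q]_x f x.
Proof.
move=> intf intG fG.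
have mf : measurable_fun setT f by case/integrableP: intf => /measurable_EFinP.
have mfq : measurable_fun setT (fun x => f x * q x) by exact: measurable_funM.
have /(integrable_law mf) intfq := intf.
have [intfc Efc] := integral_reflect c mfq intfq.
have <- : \int[mu]_x (f x * q x + f (c - x) * q (c - x)) = 2 * \int[law q]_x f x.
  rewrite RintegralD// [X in _ + X]/Rintegral Efc -/(Rintegral _ _ _).
  by rewrite -Rintegral_law// mulr2n mulrDl mul1r.
apply: le_Rintegral => //.
exact: (integrableD measurableT intfq intfc).
Qed.

Lemma Rintegral_law_opp f : symmetric_pdf q ->
  (law q).-integrable [set: R] (EFin \o f) ->
  (law q).-integrable [set: R] (fun x : R => (f (- x))%:E) /\
  \int[law q]_x f (- x) = \int[law q]_x f x.
Proof.
move=> sq intf.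
have mf : measurable_fun setT f by case/integrableP: intf => /measurable_EFinP.
have mfN : measurable_fun [set: R] (fun x : R => f (- x)).
  by apply: (measurableT_comp mf); exact: measurable_funN.
have mfq : measurable_fun setT (fun x => f x * q x) by exact: measurable_funM.
have /(integrable_law mf) intfq := intf.
have [intfc Efc] := integral_reflect 0 mfq intfq.
have E : (fun x => f (0 - x) * q (0 - x)) = (fun x => f (- x) * q x).
  by apply/funext => x; rewrite sub0r sq.
split.
  apply/(integrable_law mfN).
  by rewrite -E.
rewrite !Rintegral_law// /Rintegral -Efc; congr fine; apply: eq_integral => x _.
by rewrite sub0r sq.
Qed.

Lemma Rintegral_law_cst c : \int[law q]_x c = c.
Proof. by rewrite Rintegral_cst// -[X in fine X]/(law q setT) probability_setT mulr1. Qed.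

Lemma Rintegral_law_indic A : measurable A -> \int[law q]_x \1_A x = fine (law q A).
Proof. by move=> mA; rewrite /Rintegral integral_indic// setIT. Qed.

End expectation_wrt_density.

Section step_function.
Context (R : realType).
Notation mu := (@lebesgue_measure R).

Lemma integrable_step (c a b : R) :
  mu.-integrable [set: R] (EFin \o (fun x => c * \1_(`[a, b]%classic) x)).
Proof.
exact: (@integrableZl _ (measurableTypeR R) R mu setT measurableT c _ (integrable_indic_itv a b true false)).
Qed.

Lemma Rintegral_step (c a b : R) : a <= b ->
  \int[mu]_x (c * \1_(`[a, b]%classic) x) = c * (b - a).
Proof.
move=> ab; rewrite RintegralZl//; last exact: integrable_indic_itv.
congr (_ * _); rewrite /Rintegral integral_indic// setIT.
rewrite -[X in fine X]/(lebesgue_measure `[a, b]%classic) lebesgue_measure_itv/=.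
by rewrite lte_fin; case: ifPn => //=; rewrite -leNgt => ba; lra.
Qed.

End step_function.

(** * Logconcave densities *)

Section logconcave_bounds.
Context (R : realType) (q : density R).
Hypotheses (sq : symmetric_pdf q) (iq : isotropic (law q)) (lq : logconcave q).
Notation mu := (@lebesgue_measure R).

Let q0 x : 0 <= q x. Proof. exact: pdf_ge0. Qed.

(** Such an [x] is a convex combination of [y] and [- y], where [q] takes the same value; the two
    powers of [q y] then multiply to [q y]. *)
Lemma symmetric_logconcave_unimodal x y : `|x| <= `|y| -> q y <= q x.
Proof.
move=> xy; have [->|qy0] := eqVneq (q y) 0; first exact: q0.
have [y0|y0] := eqVneq y 0.
  by move: xy; rewrite y0 normr0 normr_le0 => /eqP ->.
pose t := (x / y + 1) / 2.
have xyy : `|x / y| <= 1 by rewrite normrM normfV ler_pdivrMr ?mul1r// normr_gt0.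
have t01 : 0 <= t <= 1 by move: xyy; rewrite ler_norml /t => /andP[? ?]; apply/andP; split; lra.
have := lq y (- y) t01.
rewrite sq -powRD ?qy0 ?implybT// (_ : t + (1 - t) = 1); last by ring.
by rewrite powRr1// (_ : t * y + (1 - t) * - y = x)// /t; field.
Qed.

Lemma integrable_sqr_isotropic :
  (law q).-integrable [set: R] (EFin \o (fun x => x ^+ 2)) /\
  \int[law q]_x (x ^+ 2) = 1.
Proof.
case: iq => E0; rewrite /variance covariance.unlock E0 /= expectation.unlock => V1.
have V : (\int[law q]_x (x ^+ 2)%:E = 1)%E.
  rewrite -V1; apply: eq_integral => x _. by rewrite -[RHS]/(((x - 0) * (x - 0))%:E) subr0 expr2.
split; last by rewrite /Rintegral V.
apply/integrableP; split; first exact/measurable_EFinP/measurable_funX.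
under eq_integral do rewrite /= ger0_norm ?sqr_ge0//.
by rewrite V ltry.
Qed.

Let int_cst c : (law q).-integrable [set: R] (EFin \o (fun=> c)).
Proof. exact: finite_measure_integrable_cst. Qed.

(** By unimodality a box of height [q y] over [[-y, y]] fits under the graph of [q]. *)
Let q_mass y : 0 < y -> q y * (2 * y) <= 1.
Proof.
move=> y0; rewrite -[X in _ <= X](Rintegral_law_cst q).
apply: le_trans (ge_Rintegral_law (int_cst 1) (integrable_step (q y) (- y) y) _).
  by rewrite Rintegral_step; [rewrite le_eqVlt; apply/orP; left; apply/eqP; ring|lra].
move=> x; rewrite mul1r indicE; case: (boolP (x \in _)) => [|_]; last by rewrite mulr0.
rewrite inE/= in_itv/= mulr1 => xy; apply: symmetric_logconcave_unimodal.
by rewrite ler_norml (ger0_norm (ltW y0)).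
Qed.

Let Q := q 0.

Let q_le_Q x : q x <= Q.
Proof. by apply: symmetric_logconcave_unimodal; rewrite normr0. Qed.

(** A parabola replaces Chebyshev: [1 - x^2 / 4] has expectation 3/4, is at most 1, and is
    nonpositive off [[-2, 2]], an interval of length 4. *)
Let Q_ge : 3 / 16 <= Q.
Proof.
have [int2 E2] := integrable_sqr_isotropic.
have int4 : (law q).-integrable [set: R] (EFin \o (fun x => 4^-1 * x ^+ 2)).
  exact: (integrableZl measurableT 4^-1 int2).
have := le_Rintegral_law (f := fun x => 1 - 4^-1 * x ^+ 2)
  (integrableB measurableT (int_cst 1) int4) (integrable_step Q (-2) 2) _.
rewrite Rintegral_step ?(RintegralB measurableT (int_cst 1) int4); last by lra.
rewrite Rintegral_law_cst (RintegralZl _ measurableT int2) E2 => h.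
suff : 1 - 4^-1 * 1 <= Q * (2 - -2) by lra.
apply: h => x; rewrite indicE; case: (boolP (x \in _)) => [_|].
  rewrite mulr1; have := q_le_Q x; have := mulr_ge0 (sqr_ge0 x) (q0 x); lra.
rewrite mulr0 notin_setE/= in_itv/= => /negP; rewrite negb_and -!ltNge => hx.
rewrite mulr_le0_ge0//; case/orP: hx => hx; nra.
Qed.

Let Q_gt0 : 0 < Q. Proof. by apply: lt_le_trans Q_ge; lra. Qed.

Let expRN1_ge : 4^-1 <= expR (-1) :> R.
Proof.
have -> : -1 = 2%:R * (- 2^-1) :> R by field.
rewrite expRM_natl; have := expR_ge1Dx (- 2^-1 : R); nra.
Qed.

(* Beyond 2/Q: [q (2 / Q) <= Q / 4] by [q_mass], and 2/Q lies between 0 and x, so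
   logconcavity forces exponential decay. *)
Let q_tail x : q x <= 4 * Q * expR (- (Q / 2 * `|x|)).
Proof.
(* Up to [2 / Q] the claimed bound is at least [4 * Q * expR (-1) >= Q]. *)
have [xQ|xQ] := leP `|x| (2 / Q).
  apply: (le_trans (q_le_Q x)).
  suff : expR (-1) <= expR (- (Q / 2 * `|x|)) by have := expRN1_ge; have := Q_gt0; nra.
  rewrite ler_expR lerN2; move: xQ; rewrite ler_pdivlMr//; have := Q_gt0; nra.
have x0 : 0 < `|x| by apply: lt_trans xQ; rewrite divr_gt0.
have [->|qx0] := eqVneq (q x) 0; first by rewrite !mulr_ge0// ?expR_ge0// ltW.
have qx : 0 < q x by rewrite lt_def qx0 q0.
(* With [t |x| = 2 / Q], logconcavity between [x] and 0 gives
   [q x ^ t * Q ^ (1 - t) <= Q * expR (-1)]. Taking logarithms and dividing by [t] yields the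
   exponent [1 / t = Q |x| / 2]. *)
pose t := 2 / (Q * `|x|).
have t0 : 0 < t by rewrite divr_gt0// mulr_gt0.
have t1 : t <= 1.
  rewrite /t ler_pdivrMr ?mulr_gt0// mul1r.
  by move: xQ; rewrite ltr_pdivrMr// => /ltW; rewrite mulrC.
have := lq x 0 (_ : 0 <= t <= 1); rewrite (ltW t0) t1 => /(_ isT).
rewrite mulr0 addr0 => h.
have qQ : q (t * x) <= Q * expR (-1).
  have -> : q (t * x) = q (2 / Q).
    have tx : `|t * x| = `|2 / Q|.
      have Q2 : 0 < 2 / Q by rewrite divr_gt0.
      rewrite normrM (gtr0_norm t0) (gtr0_norm Q2) /t; field.
      by rewrite !gt_eqF.
    by apply/le_anti/andP; split; apply: symmetric_logconcave_unimodal; rewrite tx.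
  have := q_mass (_ : 0 < 2 / Q); rewrite divr_gt0// => /(_ isT).
  rewrite !mulrA ler_pdivrMr// mul1r => hm.
  have := expRN1_ge; have := Q_gt0; nra.
have {h qQ} := le_trans h qQ.
rewrite /powR (negbTE qx0) (gt_eqF Q_gt0) -expRD -[X in X * expR (-1)](lnK (_ : Q \in Num.pos)) ?posrE//.
rewrite -expRD ler_expR => h.
have {h} : t * ln (q x) <= t * (ln Q - Q / 2 * `|x|).
  have -> : t * (ln Q - Q / 2 * `|x|) = t * ln Q - 1.
    by rewrite /t mulrBr; congr (_ - _); field; rewrite !gt_eqF.
  by move: h; rewrite -/Q; lra.
rewrite ler_pM2l// => h.
have {}h : expR (ln (q x)) <= expR (ln Q - Q / 2 * `|x|) by rewrite ler_expR.
rewrite expRD !lnK ?posrE// in h.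
apply: (le_trans h); rewrite ler_pM2r ?expR_gt0//; have := Q_gt0; lra.
Qed.

Let expR_ge_pow n (u : R) : 0 <= u -> u ^+ n.+1 <= n.+1%:R ^+ n.+1 * expR u.
Proof.
move=> u0; have -> : u = n.+1%:R * (u / n.+1%:R) by rewrite mulrC divfK ?pnatr_eq0.
rewrite expRM_natl exprMn ler_wpM2l ?exprn_ge0//.
rewrite lerXn2r ?nnegrE ?expR_ge0 ?divr_ge0//.
by apply: le_trans (expR_ge1Dx _); rewrite lerDr.
Qed.

(** A two-sided exponential profile of total mass 2. Its rate is half of the one in [q_tail]; the
    other half absorbs the power of [|x|]. *)
Let dom (x : R) := exponential_pdf (Q / 4) x + exponential_pdf (Q / 4) (- x).

Let int_dom (c : R) : mu.-integrable [set: R] (EFin \o (fun x => c * dom x)) /\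
  \int[mu]_x (c * dom x) = c * 2.
Proof.
have Q4 : 0 < Q / 4 by rewrite divr_gt0.
have i1 := integrable_exponential_pdf Q4.
have m1 := measurable_exponential_pdf (Q / 4).
have [i2 E2] := integral_reflect 0 m1 i1.
have eN : (fun x => exponential_pdf (Q / 4) (0 - x)) = (fun x => exponential_pdf (Q / 4) (- x)).
  by apply/funext => x; rewrite sub0r.
have {}i2 : mu.-integrable [set: R] (EFin \o (fun x => exponential_pdf (Q / 4) (- x))).
  by rewrite -eN.
have i3 : mu.-integrable [set: R] (EFin \o dom) by exact: (integrableD measurableT i1 i2).
split; first exact: (integrableZl measurableT c i3).
rewrite (RintegralZl _ measurableT i3) (RintegralD measurableT i1 i2).
congr (_ * _).
have E1 := integral_exponential_pdf Q4.
rewrite /Rintegral; have -> : (\int[mu]_x (exponential_pdf (Q / 4) (- x))%:E = 1)%E.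
  rewrite -E1 -E2; apply: eq_integral => x _; congr EFin.
  exact/esym/(congr1 (fun f => f x) eN).
by rewrite [X in fine X + _]E1 /=; lra.
Qed.

Lemma abs_moment_logconcave n :
  (law q).-integrable [set: R] (EFin \o (fun x => `|x| ^+ n.+1)) /\
  \int[law q]_x (`|x| ^+ n.+1) <= 32 * (4 * n.+1%:R / Q) ^+ n.+1.
Proof.
have [intd Ed] := int_dom (16 * (4 * n.+1%:R / Q) ^+ n.+1).
have mX : measurable_fun [set: R] (fun x : R => `|x| ^+ n.+1).
  exact: measurable_funX.
have qd x : `|x| ^+ n.+1 * q x <= 16 * (4 * n.+1%:R / Q) ^+ n.+1 * dom x.
  pose u := Q / 4 * `|x|.
  have u0 : 0 <= u by rewrite mulr_ge0// divr_ge0// ltW.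
  have domx : Q / 4 * expR (- u) <= dom x.
    have dom0 y : 0 <= exponential_pdf (Q / 4) y by rewrite exponential_pdf_ge0// divr_ge0// ltW.
    rewrite /dom; have [x0|x0] := leP 0 x.
      rewrite (exponential_pdfE _ x0) /u ger0_norm// mulNr.
      by have := dom0 (- x); lra.
    rewrite [X in _ <= _ + X]exponential_pdfE; last by lra.
    by rewrite /u ltr0_norm// mulNr; have := dom0 x; lra.
  have xu : `|x| = 4 / Q * u by rewrite /u; field; rewrite gt_eqF.
  have Qn : 0 <= (4 / Q) ^+ n.+1 by rewrite exprn_ge0// divr_ge0// ltW.
  have -> : (4 * n.+1%:R / Q) ^+ n.+1 = (4 / Q) ^+ n.+1 * n.+1%:R ^+ n.+1.
    by rewrite -exprMn; congr (_ ^+ _); field; rewrite gt_eqF.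
  have : `|x| ^+ n.+1 * q x <=
      ((4 / Q) ^+ n.+1 * (n.+1%:R ^+ n.+1 * expR u)) * (4 * Q * expR (- (2 * u))).
    rewrite ler_pM ?exprn_ge0//.
      by rewrite xu exprMn ler_wpM2l// expR_ge_pow.
    by apply: le_trans (q_tail x) _; rewrite /u (_ : Q / 2 * _ = 2 * (Q / 4 * `|x|))//; field.
  move=> /le_trans; apply.
  have -> : - (2 * u) = - u - u by ring.
  rewrite expRD.
  have -> : (4 / Q) ^+ n.+1 * (n.+1%:R ^+ n.+1 * expR u) * (4 * Q * (expR (- u) * expR (- u)))
      = 16 * ((4 / Q) ^+ n.+1 * n.+1%:R ^+ n.+1) * (expR u * expR (- u)) * (Q / 4 * expR (- u)).
    by field.
  by rewrite -expRD subrr expR0 mulr1 ler_wpM2l// !mulr_ge0// exprn_ge0.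
have intX : (law q).-integrable [set: R] (EFin \o (fun x => `|x| ^+ n.+1)).
  apply/integrable_law => //; apply: le_integrable intd => //.
    by apply/measurable_EFinP; apply: measurable_funM => //; exact: measurable_pdf.
  move=> x _; rewrite lee_fin ger0_norm ?mulr_ge0 ?exprn_ge0//.
  exact: le_trans (qd x) (ler_norm _).
split => //; apply: le_trans (le_Rintegral_law intX intd qd) _.
by rewrite Ed; lra.
Qed.

(** As the variance is one, the bound on the second moment reads [1 <= 2048 / Q^2], and 2048 is less
    than the square of 46. *)
Lemma pdf_logconcave_le46 x : q x <= 46.
Proof.
have [_] := abs_moment_logconcave 1.
under eq_Rintegral do rewrite real_normK ?num_real//.
have [_ ->] := integrable_sqr_isotropic => h.
apply: (le_trans (q_le_Q x)).
have : Q ^+ 2 <= 2048.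
  move: h; rewrite exprMn exprVn mulrA ler_pdivlMr ?exprn_gt0//; lra.
have := Q_gt0; nra.
Qed.

(** The constant 171 bounds [4 * 8 / Q], which is at most 512/3 since [Q >= 3 / 16]. *)
Lemma moment8_logconcave :
  (law q).-integrable [set: R] (EFin \o (fun x => `|x| ^+ 8)) /\
  \int[law q]_x (`|x| ^+ 8) <= 32 * 171 ^+ 8.
Proof.
have [i8 E8] := abs_moment_logconcave 7; split => //; apply: (le_trans E8).
rewrite ler_pM2l// lerXn2r ?nnegrE ?divr_ge0 ?(ltW Q_gt0)//.
by rewrite ler_pdivrMr//; have := Q_ge; lra.
Qed.

End logconcave_bounds.

Section growth_itv.
Context (R : realType).

Lemma growth_itv (i : interval R) : growth 0 (fun x : R => (x \in i)%:R  : R).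
Proof.
rewrite (_ : (fun x => _) = \1_[set` i]).
  by apply: growth_indic; exact: measurable_itv.
by apply/funext => x; rewrite indicE mem_setE.
Qed.

Lemma growth_lt (a : R) : growth 0 (fun x : R => (x < a)%R%:R : R).
Proof. exact: (growth_itv `]-oo, a[). Qed.

Lemma growth_gt (a : R) : growth 0 (fun x : R => (a < x)%R%:R : R).
Proof.
rewrite (_ : (fun x => _) = (fun x : R => (x \in `]a, +oo[)%:R)); first exact: growth_itv.
by apply/funext => x; rewrite in_itv/= andbT.
Qed.

Lemma growth_ge (a : R) : growth 0 (fun x : R => (a <= x)%R%:R : R).
Proof.
rewrite (_ : (fun x => _) = (fun x : R => (x \in `[a, +oo[)%:R)); first exact: growth_itv.
by apply/funext => x; rewrite in_itv/= andbT.
Qed.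

Lemma growth_cc (a b : R) : growth 0 (fun x : R => (a <= x <= b)%R%:R : R).
Proof. exact: (growth_itv `[a, b]). Qed.

Lemma growth_oo (a b : R) : growth 0 (fun x : R => (a < x < b)%R%:R : R).
Proof. exact: (growth_itv `]a, b[). Qed.

Lemma growth_gap (a b : R) : growth 0 (fun x : R => (~~ (a <= x <= b))%R%:R : R).
Proof.
rewrite (_ : (fun x => _) = (fun x : R => 1 - (a <= x <= b)%R%:R)).
  exact: growthB (growth_cst 1) (growth_cc a b).
by apply/funext => x; case: (_ <= _ <= _); rewrite /= ?subr0 ?subrr.
Qed.

End growth_itv.

(** Recursion on the expression; the exponent may be an existential variable, which the recursion
    instantiates. *)
Ltac growth_tac := lazymatch goal with
  | |- growth _ (fun x => x) => exact: growth_id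
  | |- growth _ (fun x => @GRing.exp _ (@?f x) ?n) => eapply (growthX (f := f)); growth_tac
  | |- growth _ (fun x => GRing.mul (@?f x) (@?g x)) =>
      eapply (growthM (f := f) (g := g)); growth_tac
  | |- growth _ (fun x => GRing.add (@?f x) (GRing.opp (@?g x))) =>
      eapply (growthB (f := f) (g := g)); growth_tac
  | |- growth _ (fun x => GRing.add (@?f x) (@?g x)) =>
      eapply (growthD (f := f) (g := g)); growth_tac
  | |- growth _ (fun x => GRing.opp (@?f x)) =>
      eapply (growthN (f := f)); growth_tac
  | |- growth _ (fun x => Num.norm (@?f x)) =>
      eapply (growth_norm (f := f)); growth_tac
  | |- growth _ _ => first [exact: growth_cst | exact: growth_lt | exact: growth_gt
      | exact: growth_ge | exact: growth_gap | exact: growth_cc | exact: growth_oo]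
  end.

Section linear_expectation.
Context (R : realType) (P : probability R R).
Hypothesis P8 : P.-integrable [set: R] (EFin \o (fun x => `|x| ^+ 8)).
Notation E f := (Rintegral P setT f).

(** Eight is the first even degree above the [x^7] in the remainder of the second-order expansion of
    [expR (al * x^2) * x]. *)
Definition subdeg8 (f : R -> R) := exists2 k, (k <= 8)%N & growth k f.

Lemma subdeg8B f g : subdeg8 f -> subdeg8 g -> subdeg8 (fun x => f x - g x).
Proof.
move=> [j j8 gf] [k k8 gg]; exists (maxn j k); first by rewrite geq_max j8.
exact: growthB.
Qed.

Lemma integrable_subdeg8 f : subdeg8 f -> P.-integrable [set: R] (EFin \o f).
Proof.
move=> [k k8 /(growth_le k8) [mf [C C0 fC]]].
have int1 : P.-integrable [set: R] (EFin \o (fun x => C * 2 ^+ 8 * (1 + `|x| ^+ 8))).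
  have int0 : P.-integrable [set: R] (EFin \o (fun=> 1)).
    exact: finite_measure_integrable_cst.
  exact: (integrableZl measurableT (C * 2 ^+ 8) (integrableD measurableT int0 P8)).
apply: le_integrable int1 => //; first exact/measurable_EFinP.
move=> x _; rewrite lee_fin (le_trans (fC x))// (le_trans _ (ler_norm _))//.
rewrite -mulrA ler_wpM2l//; set t := `|x|; have t0 : 0 <= t by exact: normr_ge0.
have [t1|t1] := leP t 1.
  apply: (@le_trans _ _ (2 ^+ 8)); first by rewrite lerXn2r ?nnegrE//; lra.
  by rewrite ler_peMr ?exprn_ge0// lerDl exprn_ge0.
apply: (@le_trans _ _ ((2 * t) ^+ 8)); first by rewrite lerXn2r ?nnegrE//; lra.
by rewrite exprMn ler_pM2l ?exprn_gt0// lerDr.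
Qed.

Lemma ExpD f g : subdeg8 f -> subdeg8 g -> E (fun x => f x + g x) = E f + E g.
Proof. by move=> /integrable_subdeg8 ? /integrable_subdeg8 ?; rewrite RintegralD. Qed.

Lemma ExpB f g : subdeg8 f -> subdeg8 g -> E (fun x => f x - g x) = E f - E g.
Proof. by move=> /integrable_subdeg8 ? /integrable_subdeg8 ?; rewrite RintegralB. Qed.

Lemma ExpZ c f : subdeg8 f -> E (fun x => c * f x) = c * E f.
Proof. by move=> /integrable_subdeg8 ?; rewrite RintegralZl. Qed.

Lemma le_Exp f g : subdeg8 f -> subdeg8 g -> (forall x, f x <= g x) -> E f <= E g.
Proof.
by move=> /integrable_subdeg8 ? /integrable_subdeg8 ? fg; exact: le_Rintegral.
Qed.

End linear_expectation.

Ltac subdeg8_tac := solve [eexists; [|growth_tac]; done].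

(** * Moments after removing a band *)

Definition gap (R : realType) (a b x : R) : R := (~~ (a <= x <= b))%R%:R.

Section gap_moments.
Context (R : realType) (q : density R) (a b : R).

(** This and the next two are integrals against [law q], where bounds on the density apply. That
    they are the mass, mean and variance belonging to [remove_band] is shown with the isotropized
    law. *)
Definition gap_mass := Rintegral (law q) setT (fun x => gap a b x).

Definition gap_mean := Rintegral (law q) setT (fun x => gap a b x * x) / gap_mass.

Definition gap_var :=
  Rintegral (law q) setT (fun x => gap a b x * (x - gap_mean) ^+ 2) / gap_mass.

End gap_moments.

(** * Mass, variance and eighth moment off the band *)

Section band.
Context (R : realType) (q : density R) (K eps a b : R).
Hypothesis q8 : (law q).-integrable [set: R] (EFin \o (fun x => `|x| ^+ 8)).
Hypotheses (qK : forall x, q x <= K) (K1 : 1 <= K).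
Hypotheses (E8 : \int[law q]_x (`|x| ^+ 8) <= K) (E2 : \int[law q]_x (x ^+ 2) = 1).
Hypotheses (eps0 : 0 < eps) (ab : a < b).
Hypotheses (epsl : (eps%:E <= law q `]-oo, a])%E)
  (epsm : (eps%:E <= law q `[a, b])%E) (epsr : (eps%:E <= law q `[b, +oo[)%E).
Notation E f := (Rintegral (law q) setT f).
Notation mu := (@lebesgue_measure R).

Let q0 x : 0 <= q x. Proof. exact: pdf_ge0. Qed.

Lemma Exp_cc_le x y : x <= y -> E (fun t : R => (x <= t <= y)%R%:R) <= K * (y - x).
Proof.
move=> xy; rewrite -(Rintegral_step K xy).
apply: le_Rintegral_law; [|exact: integrable_step|].
  by apply: (integrable_subdeg8 q8); subdeg8_tac.
move=> t; rewrite indicE mem_setE in_itv/=; case: (_ <= _ <= _); rewrite ?mul0r ?mul1r ?mulr0 ?mulr1//.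
Qed.

Let mass (i : interval R) : (eps%:E <= law q [set` i])%E ->
  eps <= E (fun x : R => (x \in i)%:R).
Proof.
move=> h; have -> : E (fun x : R => (x \in i)%:R) = fine (law q [set` i]).
  rewrite -Rintegral_law_indic; last exact: measurable_itv.
  by apply: eq_Rintegral => x _; rewrite indicE mem_setE.
by rewrite -lee_fin fineK// fin_num_measure//; exact: measurable_itv.
Qed.

(** The closed tail may be opened because the density is bounded, so a single point has mass at most
    [K * 0]. On the open tail [gap] equals 1. *)
Lemma mass_lt : eps <= E (fun x : R => (x < a)%R%:R).
Proof.
have h := mass epsl; have := Exp_cc_le (lexx a); rewrite subrr mulr0 => h0.
have : E (fun x : R => (x \in `]-oo, a])%:R) <=
    E (fun x : R => (x < a)%R%:R + (a <= x <= a)%R%:R).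
  apply: (le_Exp q8); [by exists 0%N; [|exact: growth_itv]|subdeg8_tac|].
  by move=> x; rewrite in_itv/=; case: ltgtP => //= _; rewrite ?addr0 ?add0r.
by rewrite (ExpD q8); [|subdeg8_tac..]; lra.
Qed.

Lemma mass_gt : eps <= E (fun x : R => (b < x)%R%:R).
Proof.
have h := mass epsr; have := Exp_cc_le (lexx b); rewrite subrr mulr0 => h0.
have : E (fun x : R => (x \in `[b, +oo[)%:R) <=
    E (fun x : R => (b < x)%R%:R + (b <= x <= b)%R%:R).
  apply: (le_Exp q8); [by exists 0%N; [|exact: growth_itv]|subdeg8_tac|].
  by move=> x; rewrite in_itv/= andbT; case: ltgtP => //= _; rewrite ?addr0 ?add0r.
by rewrite (ExpD q8); [|subdeg8_tac..]; lra.
Qed.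

Lemma mass_cc : eps <= E (fun x : R => (a <= x <= b)%R%:R).
Proof. exact: (mass epsm). Qed.

Lemma band_width : eps <= K * (b - a).
Proof. by apply: le_trans mass_cc _; exact/Exp_cc_le/ltW. Qed.

Notation g := (gap a b).
Notation Z := (gap_mass q a b).
Notation m := (gap_mean q a b).
Notation V := (gap_var q a b).

Let g_ge0 x : 0 <= g x. Proof. by rewrite /gap ler0n. Qed.
Let g_le1 x : g x <= 1. Proof. by rewrite /gap; case: (~~ _). Qed.

Lemma gap_massE : Z = 1 - E (fun x : R => (a <= x <= b)%R%:R).
Proof.
rewrite -[X in X - _](Rintegral_law_cst q) -(ExpB q8); [|subdeg8_tac..].
by apply: eq_Rintegral => x _; rewrite /gap; case: (_ <= _ <= _); rewrite /= ?subrr ?subr0.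
Qed.

Lemma gap_mass_ge : 2 * eps <= Z.
Proof.
have -> : Z = E (fun x : R => (x < a)%R%:R) + E (fun x : R => (b < x)%R%:R).
  rewrite -(ExpD q8); [|subdeg8_tac..].
  apply: eq_Rintegral => x _; rewrite /gap negb_and -!ltNge.
  case: (ltP x a) => xa; case: (ltP b x) => bx; rewrite ?addr0 ?add0r//.
  by have := ab; lra.
by have := mass_lt; have := mass_gt; lra.
Qed.

Lemma gap_mass_le : Z <= 1.
Proof. by have := mass_cc; have := eps0; rewrite gap_massE; lra. Qed.

Let Z0 : 0 < Z. Proof. by have := gap_mass_ge; have := eps0; lra. Qed.

Lemma eps_le1 : eps <= 1.
Proof. by have := gap_mass_ge; have := gap_mass_le; have := eps0; lra. Qed.

Lemma Exp_gap_id : E (fun x => g x * x) = m * Z.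
Proof. by rewrite /gap_mean divfK// gt_eqF. Qed.

Lemma Exp_gap_centered : E (fun x => g x * (x - m)) = 0.
Proof.
transitivity (E (fun x => g x * x - m * g x)).
  by apply: eq_Rintegral => x _; ring.
rewrite (ExpB q8); [|subdeg8_tac..].
by rewrite (ExpZ q8); [|subdeg8_tac]; rewrite Exp_gap_id -/Z; ring.
Qed.

Lemma Exp_gap_var : E (fun x => g x * (x - m) ^+ 2) = V * Z.
Proof. by rewrite /gap_var divfK// gt_eqF. Qed.

Lemma Exp_gap_sqr : V * Z + m ^+ 2 * Z <= 1.
Proof.
rewrite -E2; apply: (@le_trans _ _ (E (fun x => g x * x ^+ 2))); last first.
  apply: (le_Exp q8); [subdeg8_tac..|] => x.
  by rewrite ler_piMl ?sqr_ge0// g_le1.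
rewrite -Exp_gap_var.
suff -> : E (fun x => g x * (x - m) ^+ 2) = E (fun x => g x * x ^+ 2) - m ^+ 2 * Z by lra.
transitivity (E (fun x => g x * x ^+ 2 - m ^+ 2 * g x - (2 * m) * (g x * (x - m)))).
  by apply: eq_Rintegral => x _; ring.
rewrite (ExpB q8); [|subdeg8_tac..]; rewrite (ExpB q8); [|subdeg8_tac..].
rewrite (ExpZ q8); [|subdeg8_tac]; rewrite (ExpZ q8); [|subdeg8_tac].
by rewrite Exp_gap_centered -/Z; ring.
Qed.

(** Squaring [(u + v)^2 <= 2 u^2 + 2 v^2] repeatedly gives [(x - m)^8 <= 128 x^8 + 128 m^8], and
    Jensen bounds the second term by the first, whence [128 K + 128 K]. *)
Lemma Exp_gap_pow8 : E (fun x => g x * (x - m) ^+ 8) <= 256 * K.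
Proof.
have gX8 : E (fun x => g x * x ^+ 8) <= K.
  apply: le_trans E8; apply: (le_Exp q8); [subdeg8_tac..|] => x.
  by rewrite -normrX ger0_norm ?exprn_even_ge0// ler_piMl ?exprn_even_ge0// g_le1.
have m8 : m ^+ 8 * Z <= K.
  apply: le_trans gX8.
  suff : 0 <= E (fun x => g x * x ^+ 8 - m ^+ 8 * g x - (8 * m ^+ 7) * (g x * (x - m))).
    rewrite (ExpB q8); [|subdeg8_tac..]; rewrite (ExpB q8); [|subdeg8_tac..].
    rewrite (ExpZ q8); [|subdeg8_tac]; rewrite (ExpZ q8); [|subdeg8_tac].
    by rewrite Exp_gap_centered -/Z; lra.
  (* [x^8] lies above its tangent at [m]. *)
  apply: Rintegral_ge0 => x _.
  have -> : g x * x ^+ 8 - m ^+ 8 * g x - (8 * m ^+ 7) * (g x * (x - m)) =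
    g x * ((x ^+ 4 - m ^+ 4) ^+ 2 + 2 * (m ^+ 2) ^+ 2 * (x ^+ 2 - m ^+ 2) ^+ 2
      + 4 * (m ^+ 3) ^+ 2 * (x - m) ^+ 2) by ring.
  apply: mulr_ge0 (g_ge0 x) _.
  by do !(exact: sqr_ge0 || exact: ler0n || apply: addr_ge0 || apply: mulr_ge0).
apply: (@le_trans _ _ (E (fun x => 128 * (g x * x ^+ 8) + 128 * m ^+ 8 * g x))); last first.
  rewrite (ExpD q8); [|subdeg8_tac..].
  rewrite (ExpZ q8); [|subdeg8_tac]; rewrite (ExpZ q8); [|subdeg8_tac]; by rewrite -/Z; lra.
apply: (le_Exp q8); [subdeg8_tac..|] => x.
suff h : (x - m) ^+ 8 <= 128 * x ^+ 8 + 128 * m ^+ 8.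
  by have := ler_wpM2l (g_ge0 x) h; lra.
have sq2 (u v : R) : (u + v) ^+ 2 <= 2 * u ^+ 2 + 2 * v ^+ 2 by have := sqr_ge0 (u - v); nra.
have s1 : (x - m) ^+ 2 <= 2 * x ^+ 2 + 2 * m ^+ 2 by have := sqr_ge0 (x + m); nra.
have s2 : (x - m) ^+ 4 <= 8 * x ^+ 4 + 8 * m ^+ 4.
  have : ((x - m) ^+ 2) ^+ 2 <= (2 * x ^+ 2 + 2 * m ^+ 2) ^+ 2.
    rewrite lerXn2r ?nnegrE ?sqr_ge0//.
    by apply: le_trans s1; exact: sqr_ge0.
  by have := sq2 (2 * x ^+ 2) (2 * m ^+ 2); rewrite -!exprM; lra.
have : ((x - m) ^+ 4) ^+ 2 <= (8 * x ^+ 4 + 8 * m ^+ 4) ^+ 2.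
  rewrite lerXn2r ?nnegrE ?exprn_even_ge0//.
  by apply: le_trans s2; rewrite exprn_even_ge0.
by have := sq2 (8 * x ^+ 4) (8 * m ^+ 4); rewrite -!exprM; lra.
Qed.

Lemma gap_var_ge : eps / (256 * K ^+ 2) <= V.
Proof.
have K0 : 0 < K by apply: lt_le_trans K1.
have K2 : 0 < 256 * K ^+ 2 by rewrite mulr_gt0// exprn_gt0.
have V0 : 0 <= V.
  rewrite -(pmulr_lge0 _ Z0) -Exp_gap_var; apply: Rintegral_ge0 => x _.
  by rewrite mulr_ge0// sqr_ge0.
suff h : eps <= 256 * K ^+ 2 * (V * Z).
  rewrite ler_pdivrMr// mulrC; apply: (le_trans h); rewrite ler_pM2l//.
  by rewrite ler_piMr// gap_mass_le.
rewrite -Exp_gap_var.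
have far (f : R -> R) c : subdeg8 f -> 0 <= c -> eps <= E f ->
    (forall x, c * f x <= g x * (x - m) ^+ 2) -> 1 <= 256 * K ^+ 2 * c ->
    eps <= 256 * K ^+ 2 * E (fun x => g x * (x - m) ^+ 2).
  move=> sf c0 ef fg Kc.
  have : c * E f <= E (fun x => g x * (x - m) ^+ 2).
    rewrite -(ExpZ q8)//; apply: (le_Exp q8) => //; last by subdeg8_tac.
    case: sf => k k8 gk; exists (0 + k)%N => //; exact: growthM (growth_cst c) gk.
  rewrite -(ler_pM2l K2) => h; apply: le_trans h; rewrite mulrA.
  by apply: (le_trans ef); rewrite ler_peMl// (le_trans _ ef)// ltW.
(* If [Z >= 1/2], the bound on the density spreads the remaining mass; otherwise
   the band is wide and one of the two tails is far from [m]. *)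
have [Zh|Zh] := leP 2^-1 Z.
  (* An interval of radius [rho] has mass at most 1/4, so mass at least 1/4 stays outside both it
     and the band. The factor 4 below lifts this to 1, which is at least [eps]. *)
  pose rho := 8^-1 / K.
  have rho0 : 0 < rho by rewrite divr_gt0.
  have rK : rho * K = 8^-1 by rewrite /rho divfK// gt_eqF.
  have near : E (fun x : R => (m - rho <= x <= m + rho)%R%:R) <= 4^-1.
    apply: le_trans (Exp_cc_le (_ : m - rho <= m + rho)) _; lra.
  apply: (far (fun x : R => 4 * (g x - (m - rho <= x <= m + rho)%R%:R)) (rho ^+ 2 / 4)).
  - subdeg8_tac.
  - by rewrite divr_ge0// sqr_ge0.
  - rewrite (ExpZ q8); [|subdeg8_tac]; rewrite (ExpB q8); [|subdeg8_tac..].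
    by have := eps_le1; move: near Zh; rewrite /gap_mass; lra.
  - move=> x; rewrite (_ : rho ^+ 2 / 4 * (4 * _) =
      rho ^+ 2 * (g x - (m - rho <= x <= m + rho)%R%:R)); last by field.
    case: (boolP (m - rho <= x <= m + rho)) => [_|].
      apply: (@le_trans _ _ 0); last by rewrite mulr_ge0// sqr_ge0.
      by rewrite mulr_ge0_le0 ?sqr_ge0// subr_le0 g_le1.
    rewrite subr0 mulrC negb_and -!ltNge => h; apply: ler_wpM2l => //.
    rewrite -[leRHS]real_normK ?num_real// lerXn2r ?nnegrE ?(ltW rho0)//.
    by rewrite ler_normr; apply/orP; case/orP: h => h; [right|left]; lra.
  - rewrite (_ : 256 * K ^+ 2 * (rho ^+ 2 / 4) = 64 * (rho * K) ^+ 2); last by field.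
    by rewrite rK; lra.
have width : 1 <= 2 * K * (b - a).
  have := Exp_cc_le (ltW ab); have := gap_massE; have := Zh; lra.
have c0 : 0 <= ((b - a) / 2) ^+ 2 by rewrite sqr_ge0.
have Kc : 1 <= 256 * K ^+ 2 * ((b - a) / 2) ^+ 2.
  have : 1 <= (2 * K * (b - a)) ^+ 2 by rewrite exprn_ege1.
  by nra.
have [mab|mab] := leP (a + b) (2 * m).
  apply: (far (fun x : R => (x < a)%R%:R) _ _ c0 mass_lt _ Kc); first by subdeg8_tac.
  move=> x; case: (ltP x a) => xa; last by rewrite mulr0 mulr_ge0// sqr_ge0.
  by rewrite /gap [a <= x]leNgt xa/= mulr1 mul1r -[leRHS]sqrrN lerXn2r ?nnegrE//; have := ab; lra.
apply: (far (fun x : R => (b < x)%R%:R) _ _ c0 mass_gt _ Kc); first by subdeg8_tac.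
move=> x; case: (ltP b x) => xb; last by rewrite mulr0 mulr_ge0// sqr_ge0.
by rewrite /gap [x <= b]leNgt xb/= andbF mulr1 mul1r lerXn2r ?nnegrE//; have := ab; lra.
Qed.

Hypothesis unimodal : forall x y, `|x| <= `|y| -> q y <= q x.

(** For [x > 0] in the band, [a <= - b <= - x <= b] puts [- x] in the band as well. So the cut
    removes at least as much on the negative side, and reflection about 0 applies as [q] is even. *)
Lemma gap_mean_ge0 : a + b <= 0 -> 0 <= m.
Proof.
move=> ab0; rewrite -(pmulr_lge0 _ Z0) -Exp_gap_id.
have sqx x : q (- x) = q x by apply/le_anti/andP; split; apply: unimodal; rewrite normrN.
have := @reflect_Rintegral_law _ q 0 (fun x => g x * x) (fun=> 0) _ _ _.
rewrite Rintegral_cst// mul0r pmulr_rge0//; apply.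
- by apply: (integrable_subdeg8 q8); subdeg8_tac.
- exact: integrable0.
- move=> x; rewrite sub0r sqx.
  rewrite (_ : g x * x * q x + _ = (g x - g (- x)) * x * q x); last by ring.
  apply: mulr_ge0 => //; rewrite /gap.
  case: (boolP (a <= x <= b)) => /= hx; case: (boolP (a <= - x <= b)) => /= hy;
    rewrite ?subrr ?mul0r// ?subr0 ?sub0r ?mul1r ?mulN1r.
  + move/andP: hx => [ax xb]; rewrite oppr_ge0 leNgt; apply/negP => x0.
    by move: hy; rewrite negb_and -!ltNge => /orP[]; lra.
  + move/andP: hy => [ax xb]; rewrite leNgt; apply/negP => x0.
    by move: hx; rewrite negb_and -!ltNge => /orP[]; lra.
Qed.

(** * Quantitative asymmetry for a band with negative midpoint *)

Section negative_midpoint.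
Hypothesis midpoint : eps ^+ 5 <= - (a + b).

Let K0 : 0 < K. Proof. exact: lt_le_trans K1. Qed.

Let e5 : 0 < eps ^+ 5. Proof. exact: exprn_gt0. Qed.

Let m0 : 0 <= m. Proof. by apply: gap_mean_ge0; move: midpoint e5; lra. Qed.

Let a0 : a < 0. Proof. by move: midpoint e5 ab; lra. Qed.

(** If [b < m], the left tail lowers the centered first moment by at least
    [eps (m - a) >= eps (b - a) >= w]. *)
Let w := eps ^+ 2 / K.

Let w0 : 0 < w. Proof. by rewrite divr_gt0// exprn_gt0. Qed.

Let w_le : w <= eps.
Proof.
rewrite /w ler_pdivrMr// expr2 ler_pM2l//.
by apply: le_trans eps_le1 K1.
Qed.

(** So [m + beta] is the larger of [b] and its mirror image [2m - b]. *)
Let beta := `|b - m|.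

(* For [b < m]: on (b, 2m - b) the centered first moment is nonpositive by
   reflection about [m], so the contribution of (-oo, a) has to be balanced beyond
   [B = 2m - b]. *)
Let upper_mass : w ^+ 2 <= E (fun x : R => (m + beta <= x)%R%:R).
Proof.
have [mb|bm] := leP m b.
  apply: (@le_trans _ _ (E (fun x : R => (b < x)%R%:R))).
    apply: le_trans mass_gt; apply: le_trans w_le.
    by rewrite expr2 ler_piMr ?(ltW w0)// (le_trans w_le)// eps_le1.
  apply: (le_Exp q8); [subdeg8_tac..|] => x.
  have -> : m + beta = b by rewrite /beta ger0_norm ?subr_ge0//; ring.
  by case: ltgtP.
pose B := m + beta.
have BE : B = 2 * m - b by rewrite /B /beta ltr0_norm ?subr_lt0//; ring.
have inner : E (fun x : R => (b < x < B)%R%:R * (x - m)) <= 0.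
  have := @reflect_Rintegral_law _ q (2 * m) (fun x : R => - ((b < x < B)%R%:R * (x - m))) (fun=> 0) _ _ _.
  have -> : E (fun x : R => - ((b < x < B)%R%:R * (x - m))) = - E (fun x : R => (b < x < B)%R%:R * (x - m)).
    transitivity (E (fun x : R => -1 * ((b < x < B)%R%:R * (x - m)))).
      by apply: eq_Rintegral => x _; ring.
    by rewrite (ExpZ q8) ?mulN1r//; subdeg8_tac.
  rewrite Rintegral_cst// mul0r pmulr_rge0// oppr_ge0; apply.
  - by apply: (integrable_subdeg8 q8); subdeg8_tac.
  - exact: integrable0.
  - move=> x; rewrite BE.
    have -> : (b < 2 * m - x < 2 * m - b) = (b < x < 2 * m - b).
      by apply/idP/idP => /andP[? ?]; apply/andP; split; lra.
    rewrite (_ : _ + _ = (b < x < 2 * m - b)%R%:R * ((x - m) * (q (2 * m - x) - q x))); last by ring.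
    rewrite mulr_ge0//; have [xm|mx] := leP x m.
      rewrite mulr_le0 ?subr_le0// unimodal//.
      rewrite [X in _ <= X]ger0_norm; last by move: m0; lra.
      by rewrite ler_norml; apply/andP; split; move: m0; lra.
    rewrite mulr_ge0 ?subr_ge0 ?(ltW mx)// unimodal//.
    rewrite [X in _ <= X]ger0_norm; last by move: m0; lra.
    by rewrite ler_norml; apply/andP; split; move: m0; lra.
have left : E (fun x : R => (x < a)%R%:R * (x - m)) <= - (eps * (m - a)).
  apply: (@le_trans _ _ (E (fun x : R => (a - m) * (x < a)%R%:R))).
    apply: (le_Exp q8); [subdeg8_tac..|] => x.
    by case: (ltP x a) => xa; rewrite ?mul0r ?mulr0// mul1r mulr1; lra.
  rewrite (ExpZ q8); last by subdeg8_tac.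
  have am : 0 <= m - a by move: m0 a0; lra.
  by have := ler_wpM2l am mass_lt; lra.
have total : E (fun x => g x * (x - m)) <= E (fun x : R => (x < a)%R%:R * (x - m)
    + (b < x < B)%R%:R * (x - m) + (w / 2 * x ^+ 2 + (2 * w)^-1 * (B <= x)%R%:R)).
  apply: (le_Exp q8); [subdeg8_tac..|] => x.
  (* Arithmetic-geometric mean, weighted so that the square, of expectation [w / 2], uses up only
     half of the deficit [w]. The rest must be paid by the mass beyond [B]. *)
  have AG : x - m <= w / 2 * x ^+ 2 + (2 * w)^-1.
    have : 0 <= w / 2 * (x - w^-1) ^+ 2 by rewrite mulr_ge0 ?divr_ge0 ?sqr_ge0// ltW.
    rewrite (_ : w / 2 * (x - w^-1) ^+ 2 = w / 2 * x ^+ 2 - x + (2 * w)^-1); last first.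
      by field; rewrite gt_eqF.
    by move: m0; lra.
  have sq0 : 0 <= w / 2 * x ^+ 2 by rewrite mulr_ge0 ?sqr_ge0// divr_ge0// ltW.
  have := bm; rewrite /gap; have := ab => ab' bm'.
  have [xa|ax] := ltP x a; have [bx|xb] := ltP b x; have [Bx|xB] := leP B x;
    rewrite /= ?mul0r ?mul1r ?mulr1 ?mulr0 ?add0r ?addr0//; try lra.
  all: try by move: Bx; rewrite BE; lra.
rewrite (ExpD q8) in total; [|subdeg8_tac..].
rewrite (ExpD q8) in total; [|subdeg8_tac..].
rewrite (ExpD q8) in total; [|subdeg8_tac..].
rewrite (ExpZ q8) in total; [|subdeg8_tac].
rewrite (ExpZ q8) in total; [|subdeg8_tac].
rewrite Exp_gap_centered E2 mulr1 in total.
have wide : w <= eps * (m - a).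
  rewrite /w ler_pdivrMr// expr2 -mulrA ler_pM2l//.
  by apply: (le_trans band_width); rewrite mulrC ler_wpM2r ?(ltW K0)//; lra.
set P := E (fun x : R => (B <= x)%R%:R) in total *.
have {}total : w / 2 <= (2 * w)^-1 * P by move: total inner left wide; lra.
have w20 : 0 < 2 * w by rewrite mulr_gt0.
have : 2 * w * (w / 2) <= 2 * w * ((2 * w)^-1 * P) by rewrite ler_pM2l.
by rewrite mulVKf ?gt_eqF// (_ : 2 * w * (w / 2) = w ^+ 2)//; field.
Qed.

(** Small enough for three purposes: [3 delta] fits below [eps^5] and below [eps / K], the two lower
    bounds for [r - beta], and [2 delta K <= w^2 / 4] keeps the mass of an interval of length
    [2 delta] below that of the upper tail. *)
Let delta := eps ^+ 5 / (8 * K ^+ 3).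

Let delta0 : 0 < delta. Proof. by rewrite divr_gt0// mulr_gt0// exprn_gt0. Qed.

Let delta_le5 : 3 * delta <= eps ^+ 5.
Proof.
rewrite /delta mulrA ler_pdivrMr ?mulr_gt0 ?exprn_gt0// mulrC ler_pM2l//.
by have := exprn_ege1 3 K1; lra.
Qed.

Let delta_le1 : 3 * delta <= eps / K.
Proof.
have -> : delta = eps / K * (eps ^+ 4 / (8 * K ^+ 2)).
  by rewrite /delta; field; rewrite gt_eqF.
rewrite mulrCA ler_piMr ?divr_ge0 ?(ltW eps0) ?(ltW K0)//.
rewrite mulrA ler_pdivrMr ?mulr_gt0 ?exprn_gt0// mul1r.
have := exprn_ege1 2 K1; have : eps ^+ 4 <= 1 by rewrite exprn_ile1 ?(ltW eps0)// eps_le1.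
by lra.
Qed.

Let r := m - a.
Let s := Num.max 0 (m - b).

(** The difference [r - beta] is [b - a] if [b < m], and [2m - (a + b)] otherwise; the second case
    is where the size of [a + b] matters, not only its sign. *)
Let r_beta : beta + 3 * delta <= r.
Proof.
have bw : eps / K <= b - a by rewrite ler_pdivrMr// mulrC band_width.
rewrite /beta /r; case: (ltP b m) => bm.
  by rewrite ltr0_norm ?subr_lt0//; have := delta_le1; lra.
rewrite ger0_norm ?subr_ge0//; have := delta_le5; have := midpoint; have := m0; lra.
Qed.

Let beta0 : 0 <= beta. Proof. exact: normr_ge0. Qed.

Let r_ge : eps / (2 * K) <= r.
Proof.
have bw : eps / K <= b - a by rewrite ler_pdivrMr// mulrC band_width.
have -> : eps / (2 * K) = eps / K / 2 by field; rewrite gt_eqF.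
have := ler_norm (b - m); have := r_beta; have := delta0; rewrite /beta /r; lra.
Qed.

Let s_ge0 : 0 <= s. Proof. by rewrite /s le_max lexx. Qed.

Let s_le_beta : s <= beta.
Proof. by rewrite /s ge_max beta0 /beta distrC ler_norm. Qed.

Let s_ge : m - b <= s. Proof. by rewrite /s le_max lexx orbT. Qed.

(* By [upper_mass], more mass lies beyond [B] than [B, B + 2 delta] and, by
   Chebyshev, (2/w, +oo) can carry together. *)
Let edge_density : w ^+ 3 / 4 <= q (m + beta + 2 * delta).
Proof.
pose B := m + beta; pose eta := q (B + 2 * delta).
have B0 : 0 <= B by rewrite addr_ge0.
have eta0 : 0 <= eta by exact: q0.
have T0 : 0 <= 2 / w by rewrite divr_ge0// ltW.
have i1 := integrable_step K B (B + 2 * delta).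
have i2 := integrable_step eta 0 (2 / w).
(* Subtracting the parabola builds Chebyshev into the test function: it is nonpositive beyond
   [2 / w], at a cost of [w^2 / 4] in expectation. *)
have := le_Rintegral_law (q := q) (f := fun x : R => (B <= x)%R%:R - w ^+ 2 / 4 * x ^+ 2)
  _ (integrableD measurableT i1 i2) _.
rewrite (RintegralD measurableT i1 i2) Rintegral_step; last by have := delta0; lra.
rewrite Rintegral_step// (ExpB q8); [|subdeg8_tac..].
rewrite (ExpZ q8); last by subdeg8_tac.
rewrite E2 => h.
have {}h : E (fun x : R => (B <= x)%R%:R) - w ^+ 2 / 4 * 1 <=
    K * (B + 2 * delta - B) + eta * (2 / w - 0).
  apply: h; first by apply: (integrable_subdeg8 q8); subdeg8_tac.
  move=> x; rewrite !indicE !mem_setE !in_itv/=.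
  have fle : (B <= x)%R%:R - w ^+ 2 / 4 * x ^+ 2 <= 1.
    rewrite lerBlDr; apply: (@le_trans _ _ 1); first by case: (B <= x).
    by rewrite lerDl mulr_ge0 ?divr_ge0 ?sqr_ge0//.
  have fq : ((B <= x)%R%:R - w ^+ 2 / 4 * x ^+ 2) * q x <= q x by rewrite ler_piMl.
  have RHS0 : 0 <= K * (B <= x <= B + 2 * delta)%R%:R + eta * (0 <= x <= 2 / w)%R%:R.
    by apply: addr_ge0; apply: mulr_ge0 => //; exact: ltW.
  have dicho (u v : R) : u < v \/ v <= u by case: (ltP u v); [left|right].
  have [xB|Bx] := dicho x B.
    apply: le_trans RHS0; rewrite mulr_le0_ge0// [B <= x]leNgt xB/= sub0r oppr_le0.
    by rewrite mulr_ge0 ?divr_ge0 ?sqr_ge0//.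
  have [Bdx|xBd] := dicho (B + 2 * delta) x; last first.
    apply: (le_trans fq); rewrite Bx xBd/= mulr1; apply: (le_trans (qK x)).
    by rewrite lerDl mulr_ge0.
  have [Tx|xT] := dicho (2 / w) x; last first.
    apply: (le_trans fq); rewrite [x <= B + _]leNgt Bdx andbF mulr0 add0r.
    rewrite (le_trans B0 Bx) xT/= mulr1.
    apply: unimodal; rewrite !ger0_norm ?(le_trans B0)//; first exact: ltW.
    by rewrite lerDl mulr_ge0// ltW.
  apply: le_trans RHS0; rewrite mulr_le0_ge0// Bx/= subr_le0.
  have wx : 2 <= x * w by rewrite -ler_pdivrMr// ltW.
  have -> : w ^+ 2 / 4 * x ^+ 2 = (x * w) ^+ 2 / 4 by field.
  by rewrite ler_pdivlMr//; nra.
have Kd : K * (2 * delta) <= w ^+ 2 / 4.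
  have -> : K * (2 * delta) = w ^+ 2 / 4 * eps.
    by rewrite /delta /w; field; rewrite gt_eqF.
  by rewrite ler_piMr ?divr_ge0 ?sqr_ge0// eps_le1.
have {h} : w ^+ 2 / 2 <= eta * 2 / w.
  by have := upper_mass; rewrite -/B; move: h; rewrite subr0 addrAC subrr add0r mulrA; lra.
rewrite ler_pdivlMr// -/eta exprS; lra.
Qed.

Let odd_test x := (x - m) * ((x - m) ^+ 2 - s ^+ 2) * (r ^+ 2 - (x - m) ^+ 2).
Let asym x := g x * q x - g (2 * m - x) * q (2 * m - x).

Let q_reflect_le x : m <= x -> q x <= q (2 * m - x).
Proof.
move=> mx; apply: unimodal; rewrite [X in _ <= X]ger0_norm; last by have := m0; lra.
by rewrite ler_norml; apply/andP; split; have := m0; lra.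
Qed.

Let gq_le x : g x * q x <= q x. Proof. by rewrite ler_piMl// g_le1. Qed.

(** The sign of [asym x] is decided by the mirror image [2m - x]. Outside the band it contributes
    its full density, which dominates [q x] because [m >= 0] places it nearer to 0; inside the band
    it contributes nothing. *)
Let odd_test_asym_ge0 x : m <= x -> 0 <= odd_test x * asym x.
Proof.
move=> mx; rewrite /odd_test; set y := x - m.
have y0 : 0 <= y by rewrite subr_ge0.
have r0 : 0 <= r by apply: le_trans r_beta; rewrite addr_ge0// mulr_ge0// ltW.
have sr : s <= r by have := s_le_beta; have := r_beta; have := delta0; lra.
have asym_le0 : g (2 * m - x) = 1 -> asym x <= 0.
  by move=> g1; rewrite /asym g1 mul1r subr_le0 (le_trans (gq_le x))// q_reflect_le.
have [ys|sy] := ltP y s.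
  have s_pos : 0 < m - b.
    by move: ys; rewrite /s lt_max => /orP[]; have := y0; lra.
  have sE : s = m - b by rewrite /s max_r// ltW.
  apply: mulr_le0; last first.
    apply: asym_le0; rewrite /gap [_ <= b]leNgt (_ : b < 2 * m - x) ?andbF//.
    by move: ys; rewrite sE /y; lra.
  apply: mulr_le0_ge0; last by rewrite subr_ge0 lerXn2r ?nnegrE//; lra.
  by rewrite mulr_ge0_le0// subr_le0 lerXn2r ?nnegrE// ltW.
have [yr|ry] := leP y r.
  apply: mulr_ge0.
    apply: mulr_ge0; last by rewrite subr_ge0 lerXn2r ?nnegrE.
    by apply: mulr_ge0 => //; rewrite subr_ge0 lerXn2r ?nnegrE.
  rewrite /asym [g (2 * m - x)]/gap (_ : a <= 2 * m - x <= b).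
    by rewrite mul0r subr0 mulr_ge0.
  by apply/andP; split; move: yr sy s_ge; rewrite /y /r; lra.
apply: mulr_le0.
  rewrite mulr_ge0_le0//.
    by apply: mulr_ge0 => //; rewrite subr_ge0 lerXn2r ?nnegrE.
  by rewrite subr_le0 lerXn2r ?nnegrE// ltW.
apply: asym_le0; rewrite /gap [a <= _]leNgt (_ : 2 * m - x < a)//.
by move: ry; rewrite /y /r; lra.
Qed.

(** Each of [y], [y - s], [y + s], [r - y] is at least [delta] on the chosen interval, [r + y] is at
    least [eps / (2 * K)], and the last factor is [edge_density]. *)
Let kappa := delta ^+ 4 * (eps / (2 * K)) * (w ^+ 3 / 4).

(** These points lie to the right of [b] and their mirror images inside the band, so [asym x] is all
    of [q x]. *)
Let odd_test_asym_ge x : m + beta + delta <= x <= m + beta + 2 * delta ->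
  kappa <= odd_test x * asym x.
Proof.
move=> /andP[xl xu]; rewrite /odd_test; set y := x - m.
have yl : beta + delta <= y by rewrite /y; lra.
have yu : y <= beta + 2 * delta by rewrite /y; lra.
have d0 := ltW delta0.
have rK : 0 <= eps / (2 * K) by rewrite divr_ge0 ?mulr_ge0// ltW.
have -> : asym x = q x.
  rewrite /asym [g (2 * m - x)]/gap (_ : a <= 2 * m - x <= b).
    rewrite /gap [x <= b]leNgt (_ : b < x); first by rewrite andbF mul1r mul0r subr0.
    by have := ler_norm (b - m); rewrite -/beta; have := delta0; lra.
  apply/andP; split; first by have := r_beta; rewrite /r; lra.
  by have := ler_norm (m - b); rewrite distrC -/beta; lra.
rewrite /kappa; apply: ler_pM.
- by rewrite mulr_ge0// exprn_ge0.
- by rewrite divr_ge0// exprn_ge0// ltW.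
- rewrite (_ : y * (y ^+ 2 - s ^+ 2) * (r ^+ 2 - y ^+ 2) =
    y * (y - s) * (y + s) * (r - y) * (r + y)); last by ring.
  rewrite (_ : delta ^+ 4 = delta * delta * delta * delta); last by ring.
  have := s_le_beta; have := s_ge0; have := r_beta; have := r_ge => h1 h2 h3 h4.
  have e1 : delta <= y by lra.
  have e2 : delta <= y - s by lra.
  have e3 : delta <= y + s by lra.
  have e4 : delta <= r - y by lra.
  have e5' : eps / (2 * K) <= r + y by lra.
  have dd := mulr_ge0 d0 d0; have ddd := mulr_ge0 dd d0.
  exact: ler_pM (mulr_ge0 ddd d0) rK
    (ler_pM ddd d0 (ler_pM dd d0 (ler_pM d0 d0 e1 e2) e3) e4) e5'.
- apply: (le_trans edge_density); apply: unimodal.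
  have x0 : 0 <= x by have := m0; have := beta0; lra.
  by rewrite !ger0_norm// (le_trans x0).
Qed.

Lemma gap_moments_ge : exists L, [/\ 0 <= L, L <= 8 / eps &
  eps ^+ 32 / (2 ^+ 19 * K ^+ 19) <=
    L * E (fun x => g x * (x - m) ^+ 3) - E (fun x => g x * (x - m) ^+ 5)].
Proof.
have r0 : 0 <= r by apply: le_trans r_ge; rewrite divr_ge0 ?mulr_ge0// ltW.
exists (s ^+ 2 + r ^+ 2); split.
- by rewrite addr_ge0// sqr_ge0.
- have sr : s ^+ 2 <= r ^+ 2.
    rewrite lerXn2r ?nnegrE//.
    by have := s_le_beta; have := r_beta; have := delta0; lra.
  rewrite ler_pdivlMr//.
  (* Chebyshev on the left tail bounds [a] and the second moment off the band bounds [m], so that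
     [s^2 + r^2 <= 2 r^2 <= 4 m^2 + 4 a^2 <= 8 / eps]. *)
  have ea : eps * a ^+ 2 <= 1.
    rewrite -E2; apply: (@le_trans _ _ (E (fun x : R => a ^+ 2 * (x < a)%R%:R))).
      rewrite (ExpZ q8); last by subdeg8_tac.
      by rewrite mulrC ler_wpM2l ?sqr_ge0// mass_lt.
    apply: (le_Exp q8); [subdeg8_tac..|] => x.
    case: (ltP x a) => xa; last by rewrite mulr0 sqr_ge0.
    by rewrite mulr1 -sqrrN -[leRHS]sqrrN lerXn2r ?nnegrE; have := a0; lra.
  have em : eps * m ^+ 2 <= 1.
    apply: le_trans Exp_gap_sqr; apply: (@le_trans _ _ (m ^+ 2 * Z)).
      rewrite mulrC ler_wpM2l ?sqr_ge0//; apply: le_trans gap_mass_ge; have := eps0; lra.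
    rewrite lerDr mulr_ge0 ?(ltW Z0)//; apply: le_trans gap_var_ge.
    by rewrite divr_ge0 ?mulr_ge0 ?exprn_ge0// ltW.
  have : r ^+ 2 <= 2 * m ^+ 2 + 2 * a ^+ 2 by rewrite /r; have := sqr_ge0 (m + a); nra.
  move=> h; have : eps * (s ^+ 2 + r ^+ 2) <= eps * (4 * m ^+ 2 + 4 * a ^+ 2).
    by rewrite ler_pM2l//; lra.
  by lra.
have sf : subdeg8 (fun x => g x * odd_test x) by rewrite /odd_test; subdeg8_tac.
have := @reflect_Rintegral_law _ q (2 * m) (fun x => g x * odd_test x)
  (fun x => kappa * \1_(`[m + beta + delta, m + beta + 2 * delta]%classic) x)
  (integrable_subdeg8 q8 sf) (integrable_step _ _ _) _.
rewrite Rintegral_step; last by have := delta0; lra.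
have -> : E (fun x => g x * odd_test x) =
    (s ^+ 2 + r ^+ 2) * E (fun x => g x * (x - m) ^+ 3) - E (fun x => g x * (x - m) ^+ 5).
  transitivity (E (fun x => (s ^+ 2 + r ^+ 2) * (g x * (x - m) ^+ 3)
      - g x * (x - m) ^+ 5 - (s * r) ^+ 2 * (g x * (x - m)))).
    by apply: eq_Rintegral => x _; rewrite /odd_test; ring.
  rewrite (ExpB q8); [|subdeg8_tac..]; rewrite (ExpB q8); [|subdeg8_tac..].
  rewrite (ExpZ q8); [|subdeg8_tac]; rewrite (ExpZ q8); [|subdeg8_tac].
  by rewrite Exp_gap_centered mulr0 subr0.
move=> h; set M := (X in _ <= X).
(* The area of a box of height [kappa] and width [delta], halved by the folding. *)
have -> : eps ^+ 32 / (2 ^+ 19 * K ^+ 19) = kappa * delta / 2.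
  by rewrite /kappa /delta /w; field; rewrite gt_eqF.
suff : kappa * (m + beta + 2 * delta - (m + beta + delta)) <= 2 * M by lra.
apply: h => x; rewrite indicE mem_setE in_itv/=.
have -> : g x * odd_test x * q x + g (2 * m - x) * odd_test (2 * m - x) * q (2 * m - x) =
    odd_test x * asym x by rewrite /odd_test /asym; ring.
case: (boolP (_ <= x <= _)) => [xI|_]; first by rewrite mulr1 odd_test_asym_ge.
rewrite mulr0; have [mx|xm] := leP m x; first exact: odd_test_asym_ge0.
(* Both factors are odd about [m]. *)
have -> : odd_test x * asym x = odd_test (2 * m - x) * asym (2 * m - x).
  rewrite /odd_test /asym (_ : 2 * m - (2 * m - x) = x); last by ring.
  by ring.
by apply: odd_test_asym_ge0; lra.
Qed.

End negative_midpoint.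
End band.

(** * Expansion in the weight parameter *)

Section expRN_taylor.
Context (R : realType).
Implicit Types y : R.

(** Here and in the next lemma, the derivative of the difference of the two sides is the inequality
    of one order less. *)
Lemma expRN_le2 y : 0 <= y -> expR (- y) <= 1 - y + y ^+ 2 / 2.
Proof.
move=> y0.
pose f (x : R) : R := 1 - x + x ^+ 2 / 2 - expR (- x).
have df (x : R) : is_derive x 1 f (-1 + x + expR (- x)).
  by apply: is_derive_eq; rewrite /GRing.scale/=; field.
have [|c] := @MVT_segment R f (fun x => -1 + x + expR (- x)) 0 y y0 (fun x _ => df x).
  by apply: derivable_within_continuous => x _; case: (df x).
rewrite in_itv/= => /andP[c0 cy] fE.
have : 0 <= f y - f 0.
  by rewrite fE subr0 mulr_ge0//; have := expR_ge1Dx (- c); lra.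
by rewrite /f oppr0 expR0 expr0n/=; lra.
Qed.

Lemma expRN_ge3 y : 0 <= y -> 1 - y + y ^+ 2 / 2 - y ^+ 3 / 6 <= expR (- y).
Proof.
move=> y0.
pose f (x : R) : R := expR (- x) - 1 + x - x ^+ 2 / 2 + x ^+ 3 / 6.
pose f' (x : R) := 1 - x + x ^+ 2 / 2 - expR (- x).
have df (x : R) : is_derive x 1 f (f' x).
  by apply: is_derive_eq; rewrite /GRing.scale/= /f'; field.
have [|c] := @MVT_segment R f f' 0 y y0 (fun x _ => df x).
  by apply: derivable_within_continuous => x _; case: (df x).
rewrite in_itv/= => /andP[c0 cy] fE.
have : 0 <= f y - f 0.
  by rewrite fE subr0 mulr_ge0// /f'; have := expRN_le2 c0; lra.
by rewrite /f oppr0 expR0 !expr0n/=; lra.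
Qed.

End expRN_taylor.

Section gaussian_weight.
Context (R : realType).

Lemma growth_gaussian (al : R) : al <= 0 -> growth 0 (fun x : R => expR (al * x ^+ 2)).
Proof.
move=> al0; split.
  by apply: measurableT_comp => //; apply: measurable_funM => //; exact: measurable_funX.
exists 1 => // x; rewrite mul1r expr0 ger0_norm ?expR_ge0// -[leRHS]expR0 ler_expR.
by rewrite mulr_le0_ge0// sqr_ge0.
Qed.

Context (P : probability R R).
Hypothesis P8 : P.-integrable [set: R] (EFin \o (fun x => `|x| ^+ 8)).
Notation E f := (Rintegral P setT f).
Notation A n := (E (fun x : R => x ^+ n)).

Let le1X8 n (t : R) : (n <= 8)%N -> 0 <= t -> t ^+ n <= 1 + t ^+ 8.
Proof.
move=> n8 t0; have [t1|t1] := leP t 1.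
  by apply: (@le_trans _ _ 1); rewrite ?exprn_ile1// lerDl exprn_ge0.
by apply: (@le_trans _ _ (t ^+ 8)); [rewrite ler_weXn2l// ltW|rewrite lerDr].
Qed.

Let E_dominated (f : R -> R) c : subdeg8 f -> 0 <= c ->
  (forall x, `|f x| <= c * (1 + `|x| ^+ 8)) ->
  `|E f| <= c * (1 + E (fun x : R => `|x| ^+ 8)).
Proof.
move=> sf c0 fc; have := integrable_subdeg8 P8 sf => intf.
apply: (le_trans (le_normr_Rintegral measurableT intf)).
have s1 : subdeg8 (fun x : R => 1 + `|x| ^+ 8) by subdeg8_tac.
have -> : c * (1 + E (fun x : R => `|x| ^+ 8)) = E (fun x : R => c * (1 + `|x| ^+ 8)).
  rewrite (ExpZ P8)// (ExpD P8); [|subdeg8_tac..].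
  congr (_ * (_ + _)).
  by rewrite Rintegral_cst// -[X in fine X]/(P setT) probability_setT mulr1.
apply: (le_Exp P8) => //; first by case: sf => k k8 gk; exists k => //; exact: growth_norm.
by subdeg8_tac.
Qed.

Let subdeg8_gaussian al : al <= 0 -> subdeg8 (fun x : R => expR (al * x ^+ 2) * x).
Proof.
by move=> al0; exists (0 + 1)%N => //; exact: growthM (growth_gaussian al0) (growth_id R).
Qed.

(** The constant term of the exponential contributes the mean, which is zero. The remainder is of
    order [al^2 |x|^5], in the next lemma [|al|^3 |x|^7], and both powers are at most
    [1 + |x|^8]. *)
Lemma gaussian_first_moment1 al : al <= 0 -> E (fun x : R => x) = 0 ->
  `|E (fun x : R => expR (al * x ^+ 2) * x) - al * A 3| <=
    al ^+ 2 * (1 + E (fun x : R => `|x| ^+ 8)).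
Proof.
move=> al0 E1; have se := subdeg8_gaussian al0.
have s3 : subdeg8 (fun x : R => al * x ^+ 3) by subdeg8_tac.
have s1 : subdeg8 (fun x : R => x) by subdeg8_tac.
have -> : E (fun x : R => expR (al * x ^+ 2) * x) - al * A 3 =
    E (fun x : R => expR (al * x ^+ 2) * x - al * x ^+ 3 - x).
  rewrite (ExpB P8)//; last exact: subdeg8B.
  by rewrite (ExpB P8)// (ExpZ P8) ?E1 ?subr0//; subdeg8_tac.
apply: E_dominated; [by apply: subdeg8B => //; exact: subdeg8B|exact: sqr_ge0|] => x.
have -> : expR (al * x ^+ 2) * x - al * x ^+ 3 - x = (expR (al * x ^+ 2) - al * x ^+ 2 - 1) * x.
  by ring.
rewrite normrM; have y0 : 0 <= - (al * x ^+ 2) by rewrite oppr_ge0 mulr_le0_ge0// sqr_ge0.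
have h : `|expR (al * x ^+ 2) - al * x ^+ 2 - 1| <= al ^+ 2 * `|x| ^+ 4.
  have := expRN_le2 y0; have := expR_ge1Dx (al * x ^+ 2); rewrite opprK.
  rewrite ler_norml -normrX ger0_norm ?exprn_even_ge0// => h1 h2.
  have : 0 <= (al * x ^+ 2) ^+ 2 by exact: sqr_ge0.
  by move=> h3; apply/andP; split; nra.
apply: (le_trans (ler_wpM2r (normr_ge0 x) h)).
by rewrite -mulrA -exprSr ler_wpM2l ?sqr_ge0// le1X8.
Qed.

Lemma gaussian_first_moment2 al : al <= 0 -> E (fun x : R => x) = 0 ->
  `|E (fun x : R => expR (al * x ^+ 2) * x) - al * A 3 - al ^+ 2 / 2 * A 5| <=
    (- al) ^+ 3 * (1 + E (fun x : R => `|x| ^+ 8)).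
Proof.
move=> al0 E1; have se := subdeg8_gaussian al0.
have s5 : subdeg8 (fun x : R => al ^+ 2 / 2 * x ^+ 5) by subdeg8_tac.
have s3 : subdeg8 (fun x : R => al * x ^+ 3) by subdeg8_tac.
have s1 : subdeg8 (fun x : R => x) by subdeg8_tac.
have -> : E (fun x : R => expR (al * x ^+ 2) * x) - al * A 3 - al ^+ 2 / 2 * A 5 =
    E (fun x : R => expR (al * x ^+ 2) * x - al * x ^+ 3 - al ^+ 2 / 2 * x ^+ 5 - x).
  rewrite (ExpB P8)//; last by apply: subdeg8B => //; exact: subdeg8B.
  rewrite (ExpB P8)//; last exact: subdeg8B.
  rewrite (ExpB P8)// (ExpZ P8); last by subdeg8_tac.
  by rewrite (ExpZ P8) ?E1 ?subr0//; subdeg8_tac.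
have nal0 : 0 <= - al by rewrite oppr_ge0.
apply: E_dominated; [by apply: subdeg8B => //; apply: subdeg8B => //; exact: subdeg8B|exact: exprn_ge0|] => x.
have -> : expR (al * x ^+ 2) * x - al * x ^+ 3 - al ^+ 2 / 2 * x ^+ 5 - x =
    (expR (al * x ^+ 2) - al * x ^+ 2 - al ^+ 2 / 2 * x ^+ 4 - 1) * x by ring.
rewrite normrM; have y0 : 0 <= - (al * x ^+ 2) by rewrite oppr_ge0 mulr_le0_ge0// sqr_ge0.
have h : `|expR (al * x ^+ 2) - al * x ^+ 2 - al ^+ 2 / 2 * x ^+ 4 - 1| <= (- al) ^+ 3 * `|x| ^+ 6.
  have := expRN_le2 y0; have := expRN_ge3 y0; rewrite opprK.
  rewrite ler_norml -normrX ger0_norm ?exprn_even_ge0// => h1 h2.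
  have : 0 <= (- (al * x ^+ 2)) ^+ 3 by exact: exprn_ge0.
  by move=> h3; apply/andP; split; nra.
apply: (le_trans (ler_wpM2r (normr_ge0 x) h)).
by rewrite -mulrA -exprSr ler_wpM2l ?exprn_ge0// le1X8.
Qed.

Lemma gaussian_mass al : al <= 0 -> E (fun x : R => x ^+ 2) = 1 ->
  1 + al <= E (fun x : R => expR (al * x ^+ 2)) <= 1.
Proof.
move=> al0 E2; have sg : subdeg8 (fun x : R => expR (al * x ^+ 2)).
  by exists 0%N => //; exact: growth_gaussian.
have E1 : E (fun=> 1) = 1.
  by rewrite Rintegral_cst// -[X in fine X]/(P setT) probability_setT mulr1.
apply/andP; split.
  have -> : 1 + al = E (fun x : R => 1 + al * x ^+ 2).
    by rewrite (ExpD P8); [rewrite (ExpZ P8) ?E2 ?E1 ?mulr1//; subdeg8_tac|subdeg8_tac..].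
  by apply: (le_Exp P8) => // [|x]; [subdeg8_tac|exact: expR_ge1Dx].
rewrite -[leRHS]E1; apply: (le_Exp P8) => // [|x]; first by subdeg8_tac.
by rewrite -[leRHS]expR0 ler_expR mulr_le0_ge0// sqr_ge0.
Qed.

End gaussian_weight.

(** * The isotropized law *)

Section isotropized_band.
Context (R : realType) (q : density R) (a b : R).
Notation Z := (gap_mass q a b).
Notation m := (gap_mean q a b).
Notation V := (gap_var q a b).
Notation rb := (remove_band (law q) a b).
Hypothesis Z0 : 0 < Z.

Let w (x : R) : R := gap a b x / Z.

Let w_ge0 x : 0 <= w x. Proof. by rewrite divr_ge0 ?ler0n// ltW. Qed.

Let mgap : measurable_fun [set: R] (gap a b). Proof. by have [] := growth_gap a b. Qed.

Let mw : measurable_fun [set: R] w. Proof. exact: measurable_funM. Qed.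

Let gapE : gap a b = \1_(~` `[a, b]%classic).
Proof.
apply/funext => x; rewrite indicE /gap; congr (nat_of_bool _)%:R.
by apply/idP/idP; rewrite in_setC mem_setE in_itv.
Qed.

Let mgapC : measurable (~` `[a, b]%classic : set R).
Proof. exact: measurableC (measurable_itv `[a, b]). Qed.

Let law_gap : law q (~` `[a, b]%classic) = Z%:E.
Proof.
rewrite /gap_mass gapE.
by rewrite Rintegral_law_indic// fineK// fin_num_measure.
Qed.

Let rbE (A : set R) : measurable A -> rb A = (\int[law q]_(x in A) (w x)%:E)%E.
Proof.
move=> mA; rewrite /remove_band/= /mnormalize /= /mrestr setTI law_gap.
(* Positivity of [Z] discards the default branch of [mnormalize]. *)
rewrite eqe gt_eqF//= {1}/w.
under [RHS]eq_integral do rewrite gapE mulrC EFinM.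
rewrite ge0_integralZl_EFin//; last 2 first.
- by apply/measurable_EFinP; exact: measurable_indic.
- by rewrite invr_ge0 ltW.
by rewrite integral_indic// muleC setIC.
Qed.

Let Rintegral_rb (f : R -> R) : measurable_fun [set: R] f ->
  fine (\int[rb]_x (f x)%:E) = Rintegral (law q) setT (fun x => f x * w x).
Proof.
move=> mf; congr fine.
exact: (integral_pushforward_density (@measurable_id _ R setT) mw w_ge0 rbE mf).
Qed.

Hypothesis q8 : (law q).-integrable [set: R] (EFin \o (fun x => `|x| ^+ 8)).

Let Exp_w (f : R -> R) k : (k <= 8)%N -> growth k f ->
  Rintegral (law q) setT (fun x => f x * w x) =
  Rintegral (law q) setT (fun x => gap a b x * f x) / Z.
Proof.
move=> k8 fk; rewrite mulrC -(ExpZ q8).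
  by apply: eq_Rintegral => x _; rewrite /w; ring.
by exists (0 + k)%N => //; exact: growthM (growth_gap a b) fk.
Qed.

Let mean_rb : fine ('E_rb[id])%E = m.
Proof.
rewrite expectation.unlock Rintegral_rb; last exact: measurable_id.
exact: (Exp_w (isT : (1 <= 8)%N) (growth_id R)).
Qed.

Let var_rb : fine ('V_rb[id])%E = V.
Proof.
rewrite /variance covariance.unlock mean_rb expectation.unlock.
have gX : growth 2 (fun x => (x - m) ^+ 2).
  by apply: growth_le (growthX 2 (growthB (growth_id R) (growth_cst m))).
transitivity (Rintegral (law q) setT (fun x => (x - m) ^+ 2 * w x)); last first.
  exact: (Exp_w (isT : (2 <= 8)%N) gX).
rewrite -(Rintegral_rb (f := fun x => (x - m) ^+ 2)); last by case: gX.
by congr fine; apply: eq_integral => x _; rewrite expr2.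
Qed.

Lemma standardizeE x : standardize rb x = (x - m) / Num.sqrt V.
Proof. by rewrite /standardize mean_rb var_rb. Qed.

Let mstd : measurable_fun [set: R] (standardize rb).
Proof. exact: measurable_funP. Qed.

Lemma Rintegral_isotropize (f : R -> R) k : (k <= 8)%N -> growth k f ->
  (isotropize rb).-integrable [set: R] (EFin \o f) /\
  Rintegral (isotropize rb) setT f =
  Rintegral (law q) setT (fun x => gap a b x * f ((x - m) / Num.sqrt V)) / Z.
Proof.
move=> k8 fk; have [mf _] := fk.
have isoE (A : set R) : measurable A ->
    isotropize rb A = (\int[law q]_(x in standardize rb @^-1` A) (w x)%:E)%E.
  by move=> mA; rewrite -rbE// -[_ @^-1` _]setTI; exact: mstd.
have stdE : (fun x => f (standardize rb x)) = (fun x => f ((Num.sqrt V)^-1 * x + - (m / Num.sqrt V))).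
  by apply/funext => x; rewrite standardizeE; congr f; ring.
have gstd : growth k (fun x => f (standardize rb x)).
  by rewrite stdE; exact: growth_comp.
have sw : subdeg8 (fun x => f (standardize rb x) * w x).
  have -> : (fun x => f (standardize rb x) * w x) =
      (fun x => f (standardize rb x) * (gap a b x * Z^-1)) by [].
  exists (k + (0 + 0))%N; first by rewrite !addn0.
  exact: growthM gstd (growthM (growth_gap a b) (growth_cst _)).
split.
  apply/(integrable_pushforward_density mstd mw w_ge0 isoE mf).
  exact: (integrable_subdeg8 q8 sw).
rewrite /Rintegral (integral_pushforward_density mstd mw w_ge0 isoE mf).
rewrite -[LHS]/(Rintegral (law q) setT (fun x => f (standardize rb x) * w x)).
rewrite (Exp_w k8 gstd); congr (_ / _).
by apply: eq_Rintegral => x _; rewrite standardizeE.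
Qed.

End isotropized_band.

Section isotropized_moments.
Context (R : realType) (q : density R) (K eps a b : R).
Hypothesis q8 : (law q).-integrable [set: R] (EFin \o (fun x => `|x| ^+ 8)).
Hypotheses (qK : forall x, q x <= K) (K1 : 1 <= K).
Hypotheses (E8 : \int[law q]_x (`|x| ^+ 8) <= K) (E2 : \int[law q]_x (x ^+ 2) = 1).
Hypotheses (eps0 : 0 < eps) (ab : a < b).
Hypotheses (epsl : (eps%:E <= law q `]-oo, a])%E)
  (epsm : (eps%:E <= law q `[a, b])%E) (epsr : (eps%:E <= law q `[b, +oo[)%E).
Hypotheses (sq : symmetric_pdf q)
  (unimodal : forall x y, `|x| <= `|y| -> q y <= q x).
Hypothesis midpoint : eps ^+ 5 <= `|a + b|.
Notation E f := (Rintegral (law q) setT f).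
Notation Z := (gap_mass q a b).
Notation m := (gap_mean q a b).
Notation V := (gap_var q a b).
Notation hat := (isotropize (remove_band (law q) a b)).

Let Exp_opp (f : R -> R) : subdeg8 f -> E (fun x => f (- x)) = E f.
Proof. by move=> sf; have [_ ->] := Rintegral_law_opp sq (integrable_subdeg8 q8 sf). Qed.

Let law_opp (i j : interval R) : (forall x, (- x \in i) = (x \in j)) ->
  law q [set` i] = law q [set` j].
Proof.
move=> ij.
have fin (k : interval R) : law q [set` k] = (E (fun x => (x \in k)%:R))%:E.
  have mk : measurable ([set` k] : set R) by exact: measurable_itv.
  rewrite -[LHS]fineK ?fin_num_measure// -Rintegral_law_indic//.
  by congr EFin; apply: eq_Rintegral => x _; rewrite indicE mem_setE.
rewrite !fin -(Exp_opp (f := fun x => (x \in i)%:R)); last first.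
  by exists 0%N => //; exact: growth_itv.
by congr EFin; apply: eq_Rintegral => x _; rewrite ij.
Qed.

Let gapN x : gap (- b) (- a) x = gap a b (- x).
Proof.
rewrite /gap; congr (nat_of_bool (~~ _))%:R.
by apply/idP/idP => /andP[? ?]; apply/andP; split; lra.
Qed.

Let gap_massN : gap_mass q (- b) (- a) = Z.
Proof.
rewrite /gap_mass -(Exp_opp (f := fun x => gap a b x)); last by subdeg8_tac.
by apply: eq_Rintegral => x _; rewrite gapN.
Qed.

Let gap_meanN : gap_mean q (- b) (- a) = - m.
Proof.
rewrite /gap_mean gap_massN -mulNr; congr (_ / _).
have -> : - E (fun x => gap a b x * x) = E (fun x => -1 * (gap a b x * x)).
  by rewrite (ExpZ q8) ?mulN1r//; subdeg8_tac.
rewrite -[RHS]Exp_opp; last by subdeg8_tac.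
by apply: eq_Rintegral => x _; rewrite gapN; ring.
Qed.

Let gap_momentsN n : (n <= 8)%N -> odd n ->
  E (fun x => gap (- b) (- a) x * (x - gap_mean q (- b) (- a)) ^+ n) =
  - E (fun x => gap a b x * (x - m) ^+ n).
Proof.
move=> n8 on; rewrite gap_meanN.
have gX : growth n (fun x => (x - m) ^+ n).
  by have := growthX n (growthB (growth_id R) (growth_cst m)); rewrite mul1n.
have gs : subdeg8 (fun x => gap a b x * (x - m) ^+ n).
  by exists (0 + n)%N => //; exact: growthM (growth_gap a b) gX.
have -> : - E (fun x => gap a b x * (x - m) ^+ n) = E (fun x => -1 * (gap a b x * (x - m) ^+ n)).
  by rewrite (ExpZ q8) ?mulN1r.
rewrite -[RHS]Exp_opp; last first.
  exists (0 + (0 + n))%N => //.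
  exact: growthM (growth_cst _) (growthM (growth_gap a b) gX).
apply: eq_Rintegral => x _; rewrite gapN.
have -> : x - - m = - (- x - m) by ring.
by rewrite exprNn -signr_odd on expr1; ring.
Qed.

(** A positive midpoint is reduced to a negative one by passing to the band [[-b, -a]]: the evenness
    of [q] makes the odd centered moments change sign, which the absolute value hides. *)
Let gap_moments_abs : exists L, [/\ 0 <= L, L <= 8 / eps &
  eps ^+ 32 / (2 ^+ 19 * K ^+ 19) <=
   `|L * E (fun x => gap a b x * (x - m) ^+ 3) - E (fun x => gap a b x * (x - m) ^+ 5)|].
Proof.
have [ab0|ab0] := leP (a + b) 0.
  have mid : eps ^+ 5 <= - (a + b) by move: midpoint; rewrite ler0_norm.
  have [L [L0 L8 h]] := gap_moments_ge q8 qK K1 E2 eps0 ab epsl epsm epsr unimodal mid.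
  by exists L; split => //; apply: (le_trans h); exact: ler_norm.
have mid : eps ^+ 5 <= - (- b + - a).
  by move: midpoint; rewrite gtr0_norm//; lra.
have abN : - b < - a by rewrite ltrN2.
have [|||L [L0 L8 h]] := gap_moments_ge q8 qK K1 E2 eps0 abN _ _ _ unimodal mid.
- rewrite (law_opp (j := `[b, +oo[))// => x.
  by rewrite !in_itv/= andbT lerN2.
- rewrite (law_opp (j := `[a, b]))// => x.
  by rewrite !in_itv/= !lerN2 andbC.
- rewrite (law_opp (j := `]-oo, a]))// => x.
  by rewrite !in_itv/= andbT lerN2.
exists L; split => //; apply: (le_trans h); rewrite !gap_momentsN//.
by rewrite mulrN -opprD -[X in _ <= X]normrN; exact: ler_norm.
Qed.

Let e2Z : 2 * eps <= Z. Proof. exact: gap_mass_ge q8 qK ab epsl epsr. Qed.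
Let Z0 : 0 < Z. Proof. by apply: lt_le_trans e2Z; rewrite mulr_gt0. Qed.
Let e1 : eps <= 1. Proof. exact: eps_le1 q8 qK eps0 ab epsl epsm epsr. Qed.
Let K0 : 0 < K. Proof. exact: lt_le_trans K1. Qed.
Let e256 : 0 < eps / (256 * K ^+ 2).
Proof. by apply: divr_gt0 => //; apply: mulr_gt0; [exact: ltr0n|exact: exprn_gt0]. Qed.
Let V_ge : eps / (256 * K ^+ 2) <= V.
Proof. exact: gap_var_ge q8 qK K1 eps0 ab epsl epsm epsr. Qed.
Let V0 : 0 < V.
Proof. exact: lt_le_trans e256 V_ge. Qed.
Let VZ : V * Z <= 1.
Proof.
apply: le_trans (Exp_gap_sqr q8 qK E2 eps0 ab epsl epsr).
by rewrite lerDl mulr_ge0 ?sqr_ge0// ltW.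
Qed.
Let eV : eps * V <= 1.
Proof.
apply: le_trans VZ; rewrite mulrC ler_pM2l//.
by apply: le_trans e2Z; rewrite ler_peMl ?(ltW eps0)//; lra.
Qed.

Let sg := Num.sqrt V.
Let sg0 : 0 < sg. Proof. by rewrite sqrtr_gt0. Qed.
Let sg2 : sg ^+ 2 = V. Proof. by rewrite sqr_sqrtr// ltW. Qed.

Lemma isotropized_moment n : (n <= 8)%N ->
  Rintegral hat setT (fun x => x ^+ n) =
  E (fun x => gap a b x * (x - m) ^+ n) / (Z * sg ^+ n).
Proof.
move=> n8; have gX : growth n (fun x : R => x ^+ n).
  by have := growthX n (growth_id R); rewrite mul1n.
have [_ ->] := Rintegral_isotropize Z0 q8 n8 gX.
have gXm : growth n (fun x => (x - m) ^+ n).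
  by have := growthX n (growthB (growth_id R) (growth_cst m)); rewrite mul1n.
rewrite invfM mulrA mulrAC; congr (_ / _).
rewrite mulrC -(ExpZ q8); last first.
  by exists (0 + n)%N => //; exact: growthM (growth_gap a b) gXm.
by apply: eq_Rintegral => x _; rewrite exprMn exprVn -/sg; ring.
Qed.

Lemma isotropized_integrable : hat.-integrable [set: R] (EFin \o (fun x => `|x| ^+ 8)).
Proof.
have gX : growth 8 (fun x : R => `|x| ^+ 8) by have := growthX 8 (growth_norm (growth_id R)).
by have [] := Rintegral_isotropize Z0 q8 (leqnn 8) gX.
Qed.

Lemma isotropized_mean : Rintegral hat setT (fun x => x) = 0.
Proof.
rewrite -[LHS]/(Rintegral hat setT (fun x => x ^+ 1)) isotropized_moment//.
by rewrite (Exp_gap_centered q8 qK eps0 ab epsl epsr) mul0r.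
Qed.

(** Normalizing divides by [Z], at least [eps], and by the fourth power of the variance, which costs
    [eps^4] and the factor [256^4 K^8]. *)
Lemma isotropized_moment8 :
  eps ^+ 5 * (1 + Rintegral hat setT (fun x => `|x| ^+ 8)) <= 1 + 2 ^+ 40 * K ^+ 9.
Proof.
have -> : Rintegral hat setT (fun x => `|x| ^+ 8) = Rintegral hat setT (fun x => x ^+ 8).
  by apply: eq_Rintegral => x _; rewrite -normrX ger0_norm// exprn_even_ge0.
rewrite isotropized_moment// mulrDr mulr1; apply: lerD.
  by rewrite exprn_ile1// ltW.
rewrite mulrA ler_pdivrMr ?mulr_gt0 ?exprn_gt0//.
rewrite (_ : sg ^+ 8 = V ^+ 4); last by rewrite -sg2 -exprM.
have E8' := Exp_gap_pow8 q8 qK E8 eps0 ab epsl epsr.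
apply: (@le_trans _ _ (eps ^+ 5 * (256 * K))).
  by rewrite ler_pM2l// exprn_gt0.
have -> : eps ^+ 5 * (256 * K) = 2 ^+ 40 * K ^+ 9 * (eps * (eps / (256 * K ^+ 2)) ^+ 4).
  by field; rewrite gt_eqF.
have KK : 0 < 2 ^+ 40 * K ^+ 9 by rewrite mulr_gt0// exprn_gt0.
rewrite ler_pM2l//; apply: ler_pM.
- exact: ltW.
- exact/exprn_ge0/ltW.
- by have := e2Z; have := eps0; lra.
- by apply: lerXn2r; rewrite ?nnegrE; [exact: ltW|exact: ltW|exact: V_ge].
Qed.

(** Rescaling turns [L] into [L / V] and divides the contrast by [Z * sg^5]. The latter costs
    [eps^2], as [eps^2 * Z * sg^5] is the product of [V * Z], [eps * sg] and [eps * V], each at most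
    1. *)
Lemma isotropized_odd_moments : exists L, [/\ 0 <= L, eps ^+ 2 * L <= 2 ^+ 11 * K ^+ 2 &
  eps ^+ 34 / (2 ^+ 19 * K ^+ 19) <=
  `|L * Rintegral hat setT (fun x => x ^+ 3) - Rintegral hat setT (fun x => x ^+ 5)|].
Proof.
have [L [L0 L8 h]] := gap_moments_abs.
exists (L / V); split.
- by rewrite divr_ge0// ltW.
- rewrite mulrA ler_pdivrMr//.
  apply: (@le_trans _ _ (8 * eps)).
    have : eps * L <= 8 by rewrite mulrC -ler_pdivlMr.
    by move=> eL; rewrite expr2 -mulrA mulrC ler_pM2r.
  have -> : 8 * eps = 2 ^+ 11 * K ^+ 2 * (eps / (256 * K ^+ 2)) by field; rewrite gt_eqF.
  by rewrite ler_pM2l// mulr_gt0// exprn_gt0.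
have Zs : 0 < Z * sg ^+ 5 by rewrite mulr_gt0// exprn_gt0.
rewrite !isotropized_moment//.
rewrite (_ : _ - _ = (L * E (fun x => gap a b x * (x - m) ^+ 3) -
    E (fun x => gap a b x * (x - m) ^+ 5)) / (Z * sg ^+ 5)); last first.
  by rewrite -sg2; field; rewrite !gt_eqF.
rewrite normrM normfV (gtr0_norm Zs) ler_pdivlMr//.
apply: le_trans h.
have -> : eps ^+ 34 / (2 ^+ 19 * K ^+ 19) * (Z * sg ^+ 5) =
    eps ^+ 32 / (2 ^+ 19 * K ^+ 19) * (V * Z * (eps * sg) * (eps * V)).
  by rewrite -sg2; field; rewrite gt_eqF.
rewrite ler_piMr//; first by rewrite divr_ge0 ?mulr_ge0 ?exprn_ge0// ltW.
have es : eps * sg <= 1.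
  have : (eps * sg) ^+ 2 <= 1.
    rewrite exprMn sg2 expr2 -mulrA; apply: mulr_ile1 => //; first exact: ltW.
    by apply: mulr_ge0; exact: ltW.
  by have := mulr_ge0 (ltW eps0) (ltW sg0); nra.
have VZ0 : 0 <= V * Z by apply: mulr_ge0; exact: ltW.
have es0 : 0 <= eps * sg by apply: mulr_ge0; exact: ltW.
have eV0 : 0 <= eps * V by apply: mulr_ge0; exact: ltW.
by apply: mulr_ile1 => //; [exact: mulr_ge0|exact: mulr_ile1].
Qed.

End isotropized_moments.

(** * Product laws and the re-weighted mean *)

Section tuple_prob_integral.
Context d (T : measurableType d) (R : realType).

Let measurable_prod_tnth n (f : 'I_n -> T -> R) :
  (forall i, measurable_fun [set: T] (f i)) ->
  measurable_fun [set: n.-tuple T] (fun t => \prod_i f i (tnth t i)).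
Proof.
move=> mf; apply: measurable_prod => i _.
by apply: (measurableT_comp (mf i)); exact: measurable_tnth.
Qed.

Lemma integral_prod_tensor d' (T' : measurableType d') (P : probability T R)
    (Q : probability T' R) (f : T -> R) (h : T' -> R) :
  P.-integrable [set: T] (EFin \o f) -> Q.-integrable [set: T'] (EFin \o h) ->
  (P \x Q)%E.-integrable [set: T * T'] (fun z => (f z.1 * h z.2)%:E) /\
  (\int[P \x Q]_z (f z.1 * h z.2)%:E =
    ((\int[P]_x f x) * (\int[Q]_y h y))%:E)%E.
Proof.
move=> intf inth.
have mf : measurable_fun [set: T] f by case/integrableP: intf => /measurable_EFinP.
have mh : measurable_fun [set: T'] h by case/integrableP: inth => /measurable_EFinP.
have mfh : measurable_fun [set: T * T'] (fun z => (f z.1 * h z.2)%:E).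
  apply/measurable_EFinP; apply: measurable_funM.
    exact: (measurableT_comp mf measurable_fst).
  exact: (measurableT_comp mh measurable_snd).
have cZ (c : R) : (\int[Q]_y (c * h y)%:E = (c * \int[Q]_y h y)%:E)%E.
  under eq_integral do rewrite EFinM.
  by rewrite integralZl// EFinM /Rintegral fineK// integrable_fin_num.
have intfh : (P \x Q)%E.-integrable [set: T * T'] (fun z => (f z.1 * h z.2)%:E).
  apply/integrable12ltyP => //.
  have hfin : (\int[Q]_y `|(h y)%:E| \is a fin_num)%E.
    by have := integrable_fin_num measurableT (integrable_abse inth).
  have hE (x : T) : (\int[Q]_y `|(f x * h y)%:E| = `|(f x)%:E| * (\int[Q]_y `|(h y)%:E|))%E.
    under eq_integral do rewrite EFinM abseM.
    by rewrite ge0_integralZl//; do 2 apply: measurableT_comp => //.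
  under eq_integral do rewrite /= hE.
  rewrite ge0_integralZr//; last 2 first.
  - by do 2 apply: measurableT_comp => //.
  - exact: integral_ge0.
  case/integrableP: intf => _ flt.
  by rewrite muleC lte_mul_pinfty//; exact: integral_ge0.
split => //; rewrite -(integral12_prod_meas1 intfh) /fubini_F/=.
under eq_integral do rewrite cZ mulrC EFinM.
rewrite integralZl//= mulrC EFinM; congr (_ * _)%E.
by rewrite /Rintegral fineK// integrable_fin_num.
Qed.

Lemma integral_tuple_prob n (P : 'I_n -> probability T R) (f : 'I_n -> T -> R) :
  (forall i, (P i).-integrable [set: T] (EFin \o f i)) ->
  (tuple_prob P).-integrable [set: n.-tuple T] (fun t => (\prod_i f i (tnth t i))%:E) /\
  (\int[tuple_prob P]_t (\prod_i f i (tnth t i))%:E =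
   (\prod_i \int[P i]_x f i x)%:E)%E.
Proof.
elim: n P f => [|n IH] P f intf.
  have E : (fun t : 0.-tuple T => (\prod_(i < 0) f i (tnth t i))%:E) = cst 1%:E.
    by apply/funext => t; rewrite big_ord0.
  rewrite E; split; first exact: finite_measure_integrable_cst.
  by rewrite integral_cst// mul1e big_ord0 /= diracE in_setT.
have mf i : measurable_fun [set: T] (f i).
  by case/integrableP: (intf i) => /measurable_EFinP.
have [intQ EQ] := IH (fun i => P (lift ord0 i)) (fun i => f (lift ord0 i))
  (fun i => intf (lift ord0 i)).
have [intZ EZ] := integral_prod_tensor (intf ord0) intQ.
have mF : measurable_fun [set: n.+1.-tuple T] (fun t => (\prod_i f i (tnth t i))%:E).
  by apply/measurable_EFinP; exact: measurable_prod_tnth.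
have consE (z : T * n.-tuple T) : (\prod_i f i (tnth (mcons z) i))%:E =
    (f ord0 z.1 * \prod_i f (lift ord0 i) (tnth z.2 i))%:E.
  rewrite big_ord_recl; rewrite tnth0; congr (_ * _)%:E.
  by apply: eq_bigr => i _; rewrite tnthS.
have intF : (P ord0 \x tuple_prob (fun i => P (lift ord0 i)))%E.-integrable
    [set: T * n.-tuple T] ((fun t => (\prod_i f i (tnth t i))%:E) \o @mcons d T n).
  by apply: eq_integrable intZ => // z _; rewrite /= consE.
split; first exact: integrable_pushforward.
rewrite [LHS]integral_distribution//.
rewrite big_ord_recl; under eq_integral do rewrite /= consE.
by rewrite EZ /Rintegral EQ.
Qed.

End tuple_prob_integral.

Section reweighted_product.
Context (R : realType).

(** The Euclidean norm makes the weight a product over the coordinates, so the expectation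
    factors. *)
Lemma reweighted_mean_tuple_prob d (P : 'I_d -> probability R R) (al : R) i :
  al <= 0 ->
  (forall j, (P j).-integrable [set: R] (EFin \o (fun x => `|x| ^+ 8))) ->
  reweighted_mean (tuple_prob P) al 0 i =
  \prod_j Rintegral (P j) setT
    (fun x => expR (al * x ^+ 2) * (if j == i then x else 1)).
Proof.
move=> al0 P8; rewrite mxE expectation.unlock.
pose f (j : 'I_d) (x : R) := expR (al * x ^+ 2) * (if j == i then x else 1).
have intf j : (P j).-integrable [set: R] (EFin \o f j).
  apply: (integrable_subdeg8 (P8 j)); have ge := growth_gaussian al0.
  rewrite /f; case: (j == i).
    by exists (0 + 1)%N => //; exact: growthM ge (growth_id R).
  by exists (0 + 0)%N => //; exact: growthM ge (growth_cst 1).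
have [_ E] := integral_tuple_prob intf.
rewrite -[RHS]/(fine (\prod_j Rintegral (P j) setT (f j))%:E) -E.
congr fine; apply: eq_integral => t _; congr EFin.
rewrite /f big_split/= -big_mkcond/= big_pred1_eq; congr (_ * _).
rewrite /enorm sqr_sqrtr; last by apply: sumr_ge0 => j _; exact: sqr_ge0.
by rewrite mulr_sumr expR_sum.
Qed.

End reweighted_product.

Section dot_product.
Context (R : realType) (d : nat).
Implicit Types v w : 'rV[R]_d.+1.

Lemma dotrC v w : dotr v w = dotr w v.
Proof. by apply: eq_bigr => i _; rewrite mulrC. Qed.

Lemma dotr_margin_normal v : dotr v (margin_normal R d.+1) = v 0 0.
Proof.
rewrite /dotr (bigD1 0)//= big1 ?addr0 => [|i i0]; first by rewrite mxE eqxx mulr1.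
by rewrite mxE (_ : (i == 0%N :> nat) = false) ?mulr0//; apply/negbTE.
Qed.

Lemma dotr_supported0 v w : (forall i, i != 0 -> w 0 i = 0) -> dotr v w = v 0 0 * w 0 0.
Proof.
move=> w0; rewrite /dotr (bigD1 0)//= big1 ?addr0// => i i0.
by rewrite w0// mulr0.
Qed.

End dot_product.

Lemma bernoulli_ge (R : realType) (x : R) n : 0 <= x <= 1 -> 1 - n%:R * x <= (1 - x) ^+ n.
Proof.
move=> /andP[x0 x1]; elim: n => [|n IH]; first by rewrite mul0r subr0 expr0.
have n0 : 0 <= n%:R * x by rewrite mulr_ge0.
have x1' : 0 <= 1 - x by lra.
rewrite exprS; apply: le_trans (ler_wpM2l x1' IH).
by rewrite -natr1; nra.
Qed.

Ltac pos_tac := try apply: ltW; solve [repeat first [assumption | by rewrite ltr0n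
  | apply: exprn_gt0 | apply: divr_gt0 | apply: mulr_gt0]].

(* [t] stands for 1/d.  The third moment is compared with [th * eps^77 / d]: above
   this threshold the linear term dominates at [al1], below it the quadratic term
   dominates at [al2], since [c * eps^34] then bounds [`|A5|] up to a factor 2. *)
Lemma contrast_ge (R : realType) (eps t c H J A3 A5 M L F1 F2 : R) :
  0 < eps <= 1 -> 0 < t <= 1 -> 0 < c <= 1 -> 1 <= H -> 1 <= J ->
  0 <= M -> 0 <= L -> eps ^+ 2 * L <= H -> eps ^+ 5 * M <= J ->
  c * eps ^+ 34 <= `|L * A3 - A5| ->
  let c2 := c / (16 * J) in let th := c2 * c / (16 * H) in let c1 := th / (2 * J) in
  let al1 := - c1 * eps ^+ 82 * t in let al2 := - c2 * eps ^+ 42 * t in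
  `|F1 - al1 * A3| <= al1 ^+ 2 * M ->
  `|F2 - al2 * A3 - al2 ^+ 2 / 2 * A5| <= (- al2) ^+ 3 * M ->
  c1 * th / 2 * eps ^+ 159 * t ^+ 2 <= Num.max `|F1| `|F2|.
Proof.
move=> /andP[e0 e1] /andP[t0 t1] /andP[c0 c1'] H1 J1 M0 L0 eL eM A35 c2 th c1 al1 al2.
move=> hF1 hF2.
have J0 : 0 < J by lra.
have H0 : 0 < H by lra.
have c20 : 0 < c2 by rewrite divr_gt0// mulr_gt0.
have th0 : 0 < th by apply: divr_gt0; exact: mulr_gt0.
have c10 : 0 < c1 by rewrite divr_gt0// mulr_gt0.
have t2 : 0 < t ^+ 2 by rewrite exprn_gt0.
have ek k : 0 < eps ^+ k by rewrite exprn_gt0.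
have ek1 k : eps ^+ k <= 1 by rewrite exprn_ile1// ltW.
have nal1 : `|al1| = c1 * eps ^+ 82 * t.
  by rewrite /al1 !mulNr normrN gtr0_norm//; pos_tac.
have nal2 : `|al2| = c2 * eps ^+ 42 * t.
  by rewrite /al2 !mulNr normrN gtr0_norm//; pos_tac.
(* As [M] may be of order [eps^-5], the exponent 77 = 82 - 5 is where [al1 * A3] meets its error
   [al1^2 * M]; the choice of [c1] makes the error at most half of the lower bound for the linear
   term. *)
have [hA3|hA3] := leP (th * eps ^+ 77 * t) `|A3|.
  rewrite le_max; apply/orP; left.
  have l1 : c1 * th * eps ^+ 159 * t ^+ 2 <= `|al1 * A3|.
    have -> : `|al1 * A3| = c1 * eps ^+ 82 * t * `|A3|.
      by rewrite normrM nal1.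
    have -> : c1 * th * eps ^+ 159 * t ^+ 2 = c1 * eps ^+ 82 * t * (th * eps ^+ 77 * t) by ring.
    by rewrite ler_pM2l//; pos_tac.
  have l2 : al1 ^+ 2 * M <= c1 * th / 2 * eps ^+ 159 * t ^+ 2.
    have -> : al1 ^+ 2 * M = c1 ^+ 2 * eps ^+ 159 * t ^+ 2 * (eps ^+ 5 * M) by rewrite /al1; ring.
    have -> : c1 * th / 2 * eps ^+ 159 * t ^+ 2 = c1 ^+ 2 * eps ^+ 159 * t ^+ 2 * J.
      by rewrite /c1; field; rewrite gt_eqF.
    by rewrite ler_pM2l//; pos_tac.
  have := ler_normB F1 (F1 - al1 * A3); rewrite subKr.
  by move: hF1 l1 l2; lra.
rewrite le_max; apply/orP; right.
(* Below the threshold, even multiplied by [L <= H / eps^2], the third moment takes at most half of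
   the contrast, so [A5] keeps the other half. *)
have HL : L * `|A3| <= c / 2 * eps ^+ 34.
  have p1 : L * `|A3| <= L * (th * eps ^+ 77 * t) by rewrite ler_wpM2l// ltW.
  have p2 : L * (th * eps ^+ 77 * t) = eps ^+ 2 * L * (th * eps ^+ 34 * (eps ^+ 41 * t)) by ring.
  have p3 : eps ^+ 2 * L * (th * eps ^+ 34 * (eps ^+ 41 * t)) <= H * (th * eps ^+ 34 * 1).
    apply: ler_pM => //.
    - by rewrite mulr_ge0// ltW.
    - pos_tac.
    - rewrite ler_pM2l; [apply: mulr_ile1 => //; exact: ltW|pos_tac].
  have p4 : H * th <= c / 2.
    have -> : H * th = c * (c2 / 16) by rewrite /th; field; rewrite gt_eqF.
    rewrite ler_pM2l//; suff : c2 <= 1 by lra.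
    by rewrite /c2 ler_pdivrMr ?mulr_gt0//; lra.
  have p5 : H * (th * eps ^+ 34 * 1) <= c / 2 * eps ^+ 34.
    by rewrite mulr1 mulrA ler_pM2r.
  by apply: (le_trans p1); rewrite p2; exact: le_trans p3 p5.
have A5ge : c / 2 * eps ^+ 34 <= `|A5|.
  have := ler_normB (L * A3) A5; rewrite normrM (ger0_norm L0) => h.
  by lra.
pose U := eps ^+ 118 * t ^+ 2.
have U0 : 0 < U by rewrite mulr_gt0.
have q1 : c2 ^+ 2 * c / 4 * U <= al2 ^+ 2 / 2 * `|A5|.
  have -> : c2 ^+ 2 * c / 4 * U = al2 ^+ 2 / 2 * (c / 2 * eps ^+ 34).
    by rewrite /U /al2; field.
  by apply: ler_wpM2l => //; rewrite divr_ge0// sqr_ge0.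
have c2U : 0 < c2 * U by rewrite mulr_gt0.
have q2 : `|al2 * A3| <= c2 * th * U.
  have -> : `|al2 * A3| = c2 * eps ^+ 42 * t * `|A3|.
    by rewrite normrM nal2.
  apply: (@le_trans _ _ (c2 * eps ^+ 42 * t * (th * eps ^+ 77 * t))).
    by apply: ler_wpM2l; [pos_tac|exact: ltW].
  rewrite (_ : c2 * eps ^+ 42 * t * (th * eps ^+ 77 * t) = c2 * th * U * eps); last by rewrite /U; ring.
  by rewrite ler_piMr//; pos_tac.
have q3 : (- al2) ^+ 3 * M <= c2 ^+ 3 * J * U.
  have -> : (- al2) ^+ 3 * M = c2 ^+ 3 * U * ((eps ^+ 5 * M) * (eps ^+ 3 * t)) by rewrite /U /al2; ring.
  have -> : c2 ^+ 3 * J * U = c2 ^+ 3 * U * (J * 1) by ring.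
  apply: ler_wpM2l; first by pos_tac.
  apply: ler_pM => //.
  - by rewrite mulr_ge0// ltW.
  - pos_tac.
  - by apply: mulr_ile1 => //; exact: ltW.
(* The quadratic term has coefficient 1/4. The linear term and the cubic error take at most 1/16
   each, by the choice of [th] and of [c2]. *)
have q4 : c2 ^+ 2 * c / 8 * U <= `|F2|.
  have r2 : `|al2 ^+ 2 / 2 * A5| <= `|F2| + `|al2 * A3| + `|F2 - al2 * A3 - al2 ^+ 2 / 2 * A5|.
    have := ler_normB (F2 - al2 * A3) (F2 - al2 * A3 - al2 ^+ 2 / 2 * A5).
    rewrite subKr => h; apply: (le_trans h).
    by rewrite lerD2r ler_normB.
  have r3 : `|al2 ^+ 2 / 2 * A5| = al2 ^+ 2 / 2 * `|A5|.
    by rewrite normrM ger0_norm// divr_ge0// sqr_ge0.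
  have r4 : c2 ^+ 3 * J = c2 ^+ 2 * c / 16 by rewrite /c2; field; rewrite gt_eqF.
  have r5 : c2 * th <= c2 ^+ 2 * c / 16.
    rewrite (_ : c2 ^+ 2 * c / 16 = c2 * (th * H)); last by rewrite /th; field; rewrite gt_eqF.
    by rewrite ler_pM2l// ler_peMr// (ltW th0).
  have r6 : c2 * th * U <= c2 ^+ 2 * c / 16 * U by rewrite ler_pM2r.
  by rewrite r4 in q3; move: r2 r6 q1 q2 q3 hF2; rewrite r3; lra.
apply: le_trans q4.
have s1 : c1 * th / 2 <= c2 ^+ 2 * c / 8.
  have thc : th <= c2 * c / 16.
    rewrite /th ler_pM2l; last by pos_tac.
    by rewrite lef_pV2 ?posrE; [lra|pos_tac|pos_tac].
  have c1th : c1 <= th by rewrite /c1 ler_pdivrMr ?mulr_gt0// ler_peMr ?(ltW th0)//; lra.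
  have c2c : 0 < c2 * c by rewrite mulr_gt0.
  have : c1 * th <= th * th by rewrite ler_pM2r.
  have : th * th <= c2 * c / 16 * (c2 * c / 16) by apply: ler_pM => //; exact: ltW.
  have : c2 * c * (c2 * c) <= c2 ^+ 2 * c.
    by rewrite (_ : c2 * c * (c2 * c) = c2 ^+ 2 * c * c); [rewrite ler_piMr//; pos_tac|ring].
  have : 0 < c2 ^+ 2 * c by pos_tac.
  by lra.
(* Here [eps^118] would do; the exponent 159 = 82 + 77 = 118 + 41 is dictated by the other case. *)
rewrite (_ : _ * t ^+ 2 = c1 * th / 2 * (U * eps ^+ 41)); last by rewrite /U; ring.
apply: ler_pM => //.
- pos_tac.
- pos_tac.
- by rewrite ler_piMr// ltW.
Qed.

Section reweighted_margin.
Context (R : realType) (q : density R) (a b : R) (n : nat).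
Notation hat := (isotropize (remove_band (law q) a b)).
Notation mu al := (reweighted_mean (margin_prob q a b n.+1) al).
Hypothesis q8 : (law q).-integrable [set: R] (EFin \o (fun x => `|x| ^+ 8)).
Hypothesis hat8 : hat.-integrable [set: R] (EFin \o (fun x => `|x| ^+ 8)).

Let all8 (j : 'I_n.+1) :
  (if j == 0%N :> nat then hat else law q).-integrable [set: R] (EFin \o (fun x => `|x| ^+ 8)).
Proof. by case: ifP. Qed.

Lemma reweighted_mean_margin0 al : al <= 0 -> mu al 0 0 =
  Rintegral hat setT (fun x => expR (al * x ^+ 2) * x) *
  Rintegral (law q) setT (fun x => expR (al * x ^+ 2)) ^+ n.
Proof.
move=> al0; rewrite reweighted_mean_tuple_prob// big_ord_recl; congr (_ * _).
rewrite -[in RHS](card_ord n) -prodr_const; apply: eq_bigr => j _.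
by apply: eq_Rintegral => x _; rewrite mulr1.
Qed.

Lemma reweighted_mean_marginS al i : symmetric_pdf q -> al <= 0 -> i != 0 -> mu al 0 i = 0.
Proof.
have oppK0 (y : R) : - y = y -> y = 0 by lra.
move=> sq al0 i0; rewrite reweighted_mean_tuple_prob// (bigD1 i)//= eqxx.
rewrite (_ : (i == 0%N :> nat) = false); last exact/negbTE.
have se : subdeg8 (fun x : R => expR (al * x ^+ 2) * x).
  by exists (0 + 1)%N => //; exact: growthM (growth_gaussian al0) (growth_id R).
have [_] := Rintegral_law_opp sq (integrable_subdeg8 q8 se).
have -> : Rintegral (law q) setT (fun x : R => expR (al * (- x) ^+ 2) * - x) =
    - Rintegral (law q) setT (fun x : R => expR (al * x ^+ 2) * x).
  rewrite -mulN1r -(ExpZ q8 _ se); apply: eq_Rintegral => x _.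
  by rewrite sqrrN mulrN mulN1r.
by move=> /oppK0 E; rewrite [X in X * _]E mul0r.
Qed.

End reweighted_margin.

(** The constants are functions of [K] alone and are fixed before [eps], [q], the band and the
    dimension; an absolute [K] therefore makes them absolute. *)
Lemma contrast_margin (R : realType) (K : R) : 1 <= K ->
  exists c1 c2 C : R, [/\ 0 < c1, 0 < c2, 0 < C &
    forall (eps : R) (q : density R) (a b : R) (d : nat),
      (forall x, q x <= K) ->
      (law q).-integrable [set: R] (EFin \o (fun x => `|x| ^+ 8)) ->
      \int[law q]_x (`|x| ^+ 8) <= K ->
      \int[law q]_x (x ^+ 2) = 1 ->
      (forall x y, `|x| <= `|y| -> q y <= q x) ->
      0 < eps ->
      symmetric_pdf q ->
      a < b ->
      (eps%:E <= law q `]-oo, a])%E ->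
      (eps%:E <= law q `[a, b])%E ->
      (eps%:E <= law q `[b, +oo[)%E ->
      (0 < d)%N ->
      eps ^+ 5 <= `|a + b| ->
      let P := margin_prob q a b d in
      let u := margin_normal R d in
      let mu1 := reweighted_mean P (- c1 * eps ^+ 82 / d%:R) in
      let mu2 := reweighted_mean P (- c2 * eps ^+ 42 / d%:R) in
      C * eps ^+ 159 / d%:R ^+ 2 < Num.max `|dotr u mu1| `|dotr u mu2| /\
      forall v : 'rV[R]_d, dotr v u = 0 -> dotr v mu1 = 0 /\ dotr v mu2 = 0].
Proof.
move=> K1; have K0 : 0 < K by lra.
pose H := 2 ^+ 11 * K ^+ 2; pose J := 1 + 2 ^+ 40 * K ^+ 9.
pose c := (2 ^+ 19 * K ^+ 19)^-1.
pose c2 := c / (16 * J); pose th := c2 * c / (16 * H); pose c1 := th / (2 * J).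
have pow_ge1 m n : 1 <= (2 : R) ^+ m * K ^+ n.
  by apply: mulr_ege1; apply: exprn_ege1 => //; lra.
have H1 : 1 <= H by exact: pow_ge1.
have J1 : 1 <= J by rewrite /J; have := pow_ge1 40 9; lra.
have c01 : 0 < c <= 1.
  have := pow_ge1 19 19; rewrite /c => h; rewrite invr_gt0 invf_le1; first by lra.
  by lra.
have c0 : 0 < c by case/andP: c01.
have cE x : x / (2 ^+ 19 * K ^+ 19) = c * x by rewrite mulrC.
have HE : 2 ^+ 11 * K ^+ 2 = H by [].
have JE : 1 + 2 ^+ 40 * K ^+ 9 = J by [].
clearbody c J H.
have J0 : 0 < J by lra.
have H0 : 0 < H by lra.
have c20 : 0 < c2 by rewrite /c2; pos_tac.
have th0 : 0 < th by rewrite /th; pos_tac.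
have c10 : 0 < c1 by rewrite /c1; pos_tac.
(* With [c1] and [c2] at most 1/2, both weights satisfy [- al <= 1 / (2d)], which keeps the product
   of the other factors away from 0. *)
have c2_le : c2 <= 2^-1.
  rewrite /c2 ler_pdivrMr; last by pos_tac.
  by case/andP: c01; lra.
have th_le : th <= 1.
  rewrite /th ler_pdivrMr; last by pos_tac.
  have : c2 * c <= 1 by case/andP: c01 => ? ?; apply: mulr_ile1; lra.
  by lra.
have c1_le : c1 <= 2^-1.
  by rewrite /c1 ler_pdivrMr; [lra|pos_tac].
(* The factor [c1 * th / 2] of [contrast_ge] is halved by the weights of the other coordinates and
   once more to make the inequality strict. *)
exists c1, c2, (c1 * th / 8); split; [exact: c10|exact: c20|by pos_tac|].
move=> eps q a b d qK q8 E8 E2 uni e0 sq ab ml mm mr d0 mid.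
case: d d0 => // n _ P u mu1 mu2.
have e1 : eps <= 1 := eps_le1 q8 qK e0 ab ml mm mr.
have e01 : 0 < eps <= 1 by rewrite e0.
have ek1 k : eps ^+ k <= 1 by rewrite exprn_ile1// ltW.
have n0 : 0 < n.+1%:R :> R by rewrite ltr0n.
pose t : R := n.+1%:R^-1.
have t0 : 0 < t by rewrite invr_gt0.
have t1 : t <= 1 by rewrite invf_le1// ler1n.
have t01 : 0 < t <= 1 by rewrite t0.
have al_le0 (k : R) m : 0 < k -> - k * eps ^+ m * t <= 0.
  by move=> k0; rewrite !mulNr oppr_le0; pos_tac.
have al_ge (k : R) m : 0 < k -> k <= 2^-1 -> - (t / 2) <= - k * eps ^+ m * t.
  move=> k0 k2; rewrite !mulNr lerN2 [t / 2]mulrC ler_pM2r//.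
  by apply: (le_trans _ k2); rewrite ler_piMr// ltW.
have hat8 := isotropized_integrable q8 qK e0 ab ml mr.
have hat1 := isotropized_mean q8 qK e0 ab ml mr.
have hatJ := isotropized_moment8 q8 qK K1 E8 e0 ab ml mm mr.
have [L [L0 HL hL]] := isotropized_odd_moments q8 qK K1 E2 e0 ab ml mm mr sq uni mid.
rewrite cE in hL; rewrite HE in HL; rewrite JE in hatJ.
have M0 : 0 <= 1 + Rintegral (isotropize (remove_band (law q) a b)) setT (fun x => `|x| ^+ 8).
  by apply: addr_ge0 => //; apply: Rintegral_ge0 => x _; exact: exprn_ge0.
have al10 := al_le0 _ 82%N c10; have al20 := al_le0 _ 42%N c20.
have := contrast_ge e01 t01 c01 H1 J1 M0 L0 HL hatJ hL
  (gaussian_first_moment1 hat8 al10 hat1) (gaussian_first_moment2 hat8 al20 hat1).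
set F1 := Rintegral _ _ _; set F2 := Rintegral _ _ _ => main.
(* Each of the [n] symmetric factors is at least [1 + al >= 1 - 1 / (2 (n + 1))], so by Bernoulli
   their product is at least 1/2. *)
have weight_ge al : al <= 0 -> - (t / 2) <= al ->
    2^-1 <= Rintegral (law q) setT (fun x => expR (al * x ^+ 2)) ^+ n.
  move=> al0 alt; have /andP[G1 _] := gaussian_mass q8 al0 E2.
  have t2 : 0 <= t / 2 <= 1 by clear -t0 t1; lra.
  have nt : n%:R * t <= 1 by rewrite -ler_pdivlMr// /t invrK mul1r ler_nat.
  apply: (@le_trans _ _ ((1 - t / 2) ^+ n)).
    by apply: le_trans (bernoulli_ge n t2); clear -nt; lra.
  have h0 : 0 <= 1 - t / 2 by rewrite subr_ge0; case/andP: t2.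
  have h1 := le_trans (_ : 1 - t / 2 <= 1 + al) G1; rewrite lerD2l in h1.
  by apply: lerXn2r; rewrite ?nnegrE ?h0 ?h1// (le_trans h0)// h1.
have muS al : al <= 0 -> forall i, i != 0 -> reweighted_mean P al 0 i = 0.
  by move=> al0 i i0; exact: (reweighted_mean_marginS q8 hat8 sq al0 i0).
have mu_ge al : al <= 0 -> - (t / 2) <= al ->
    2^-1 * `|Rintegral (isotropize (remove_band (law q) a b)) setT
        (fun x => expR (al * x ^+ 2) * x)| <= `|dotr u (reweighted_mean P al)|.
  move=> al0 alt; rewrite dotrC dotr_margin_normal (reweighted_mean_margin0 n q8 hat8 al0).
  have wg := weight_ge al al0 alt.
  rewrite normrM mulrC ler_wpM2l// ger0_norm//.
  by apply: le_trans wg; rewrite invr_ge0.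
split; last first.
  move=> v; rewrite dotr_margin_normal => v0.
  by split; rewrite dotr_supported0 ?v0 ?mul0r//; exact: muS.
have lt1 : c1 * th / 8 * eps ^+ 159 / n.+1%:R ^+ 2 < 2^-1 * (c1 * th / 2 * eps ^+ 159 * t ^+ 2).
  rewrite -exprVn -/t.
  have : 0 < c1 * th * eps ^+ 159 * t ^+ 2 by pos_tac.
  by clear; lra.
apply: (lt_le_trans lt1).
have half0 : 0 <= 2^-1 :> R by rewrite invr_ge0.
apply: (le_trans (ler_wpM2l half0 main)).
have m1 : 2^-1 * `|F1| <= `|dotr u mu1| by apply: mu_ge => //; exact: al_ge.
have m2 : 2^-1 * `|F2| <= `|dotr u mu2| by apply: mu_ge => //; exact: al_ge.
rewrite [Num.max `|F1| _]maxEle le_max; apply/orP.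
by case: ifP => _; [right|left].
Qed.

Theorem lemma8 (R : realType) :
  exists c1 c2 C : R, [/\ 0 < c1, 0 < c2, 0 < C &
    forall (eps : R) (q : density R) (a b : R) (d : nat),
      0 < eps ->
      symmetric_pdf q -> isotropic (law q) -> logconcave q ->
      a < b ->
      (eps%:E <= law q `]-oo, a])%E ->
      (eps%:E <= law q `[a, b])%E ->
      (eps%:E <= law q `[b, +oo[)%E ->
      (0 < d)%N ->
      eps ^+ 5 <= `|a + b| ->
      let P := margin_prob q a b d in
      let u := margin_normal R d in
      let mu1 := reweighted_mean P (- c1 * eps ^+ 82 / d%:R) in
      let mu2 := reweighted_mean P (- c2 * eps ^+ 42 / d%:R) in
      C * eps ^+ 159 / d%:R ^+ 2 < Num.max `|dotr u mu1| `|dotr u mu2| /\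
      forall v : 'rV[R]_d, dotr v u = 0 -> dotr v mu1 = 0 /\ dotr v mu2 = 0].
Proof.
(* The bound on the eighth moment; it also exceeds the bound 46 on the density. *)
pose K : R := 32 * 171 ^+ 8.
have K46 : 46 <= K.
  have : 1 <= (171 : R) ^+ 8 by apply: exprn_ege1; lra.
  by rewrite /K => h; lra.
have K1 : 1 <= K by lra.
have pdfK (q : density R) : symmetric_pdf q -> isotropic (law q) -> logconcave q ->
    forall x, q x <= K.
  by move=> sq iq lq x; apply: le_trans K46; exact: pdf_logconcave_le46.
have moment8 := @moment8_logconcave R.
rewrite -/K in moment8; clearbody K.
have [c1 [c2 [C [c10 c20 C0 main]]]] := contrast_margin K1.
exists c1, c2, C; split => // eps q a b d e0 sq iq lq ab ml mm mr d0 mid.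
have [q8 E8] := moment8 q sq iq lq.
have [_ E2] := integrable_sqr_isotropic iq.
exact: (main eps q a b d (pdfK q sq iq lq) q8 E8 E2
  (symmetric_logconcave_unimodal sq lq) e0 sq ab ml mm mr d0 mid).
Qed.
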